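(* For non-negative integers $l_1,\dots,l_t$ and an integer $L$, let $N(l_1,\dots,l_t;L)$ be the number of solutions of the equation $x_1+\cdots+x_t=L$ such that, for each $i$, $x_i$ is an integer between $0$ and $l_i$. Let $r,s\ge1$. Then the coefficient of a monomial $\prod_{i=1}^tR_{j_i}$ of graded degree $r+s$ (that is, $j_1+\cdots+j_t=r+s$, with all $j_i\ge 2$) in $K'_{r,s}$ is $$\frac{r\cdot s}{t}\;|\mathrm{Perm}(\mathbf{j})|\;N(j_1-2,\dots,j_t-2;\,r-t),$$ where $\mathbf{j}=(j_1,\dots,j_t)$.
   Context: $\mathrm{Perm}(\mathbf{j})$ is the set of sequences equal to $\mathbf{j}$ up to a permutation of its terms. $\mathbf{p}=(p_1,p_2,\dots)$ and $\mathbf{q}=(q_1,q_2,\dots)$ are two infinite families of indeterminates, and $\mathbb{N}^\star=\{1,2,\dots\}$. For a permutation $\tau$, $C(\tau)$ denotes its set of orbits (fixed points included). For $\tau,\overline{\tau}\in S(k)$, $$N^{\tau,\overline{\tau}}=\sum_{\psi}\ \prod_{w\in C(\tau)}p_{\psi(w)}\prod_{b\in C(\overline{\tau})}q_{\psi(b)}\in\mathbb{C}[[\mathbf{p},\mathbf{q}]],$$ the sum running over all functions $\psi:C(\tau)\sqcup C(\overline{\tau})\to\mathbb{N}^\star$ such that $\psi(b)\ge\psi(w)$ whenever $w\in C(\tau)$ and $b\in C(\overline{\tau})$ satisfy $w\cap b\ne\emptyset$. For $l\ge1$, the free cumulant $R_{l+1}$, viewed as a power series, is $$R_{l+1}=\sum_{\substack{\tau,\overline{\tau}\in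 S(l)\\ \tau\overline{\tau}=(1\,2\,\ldots\,l)\\ |C(\tau)|+|C(\overline{\tau})|=l+1}}(-1)^{|C(\tau)|+1}N^{\tau,\overline{\tau}};$$ these power series are algebraically independent. The grading on polynomials in the $R_i$ is given by $\deg R_i=i$. For a partition $\mu\vdash k$ and $\sigma\in S(k)$ of cycle type $\mu$, put $\Sigma'_\mu=\sum(-1)^{|C(\tau)|+1}N^{\tau,\overline{\tau}}$, the sum over pairs $\tau,\overline{\tau}\in S(k)$ with $\tau\overline{\tau}=\sigma$ and such that the group generated by $\tau,\overline{\tau}$ acts transitively on $\{1,\dots,k\}$. $K'_\mu$ is the (unique) polynomial such that $\Sigma'_\mu=K'_\mu(R_2,\dots,R_{k+1})$. $K'_{r,s}$ denotes $K'_\mu$ for $\mu$ the partition of $k=r+s$ with the two parts $r$ and $s$. *)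

(* Defs.v *)
From HB Require Import structures.
From mathcomp Require Import all_boot all_order all_algebra all_fingroup.
From mathcomp Require Import finmap multiset.
From mathcomp Require Import complex.
From mathcomp Require Import mpoly.
From mathcomp Require Import boolp classical_sets functions cardinality fsbigop reals.

Set Implicit Arguments.
Unset Strict Implicit.
Unset Printing Implicit Defensive.

Import Order.TTheory GRing.Theory Num.Theory.

Local Open Scope classical_set_scope.
Local Open Scope mset_scope.
Local Open Scope ring_scope.

(* Formal power series in the (possibly infinitely many) indeterminates I.
   A monomial is a finite multiset of indeterminates, the product of monomials
   being the sum of multisets. *)
Record mseries (I : choiceType) (R : comNzRingType) :=
  MSeries { mscoef : {mset I} -> R }.

Section MSeriesRing.
Context {I : choiceType} {R : comNzRingType}.
Local Notation S := (mseries I R).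
Local Notation M := {mset I}.
Implicit Types (f g h : S) (m n d e : M) (a b : R).

HB.instance Definition _ := [isNew for (@mscoef I R)].
HB.instance Definition _ := gen_eqMixin S.
HB.instance Definition _ := gen_choiceMixin S.

Lemma mseriesP f g : mscoef f =1 mscoef g <-> f = g.
Proof.
split=> [|->//]; case: f g => [f] [g] /= fg; congr MSeries; exact/funext.
Qed.

Lemma finite_mdivs m : finite_set [set d | d `<=` m].
Proof.
set N := (\max_(x : finsupp m) m (val x))%N.
pose g (u : {ffun finsupp m -> 'I_N.+1}) : M :=
  [fsfun x : finsupp m => val (u x)].
apply: (@sub_finite_set _ _ (g @` setT)); last exact/finite_image/finite_finset.
move=> d /= /msubsetP dm; exists [ffun x => inord (d (val x))] => //.
apply/msetP => x; rewrite /g fsfun_ffun; case: insubP => [y _ <-|] /=.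
  rewrite ffunE inordK // ltnS (leq_trans (dm _)) //.
  exact: (leq_bigmax (F := fun x : finsupp m => m (val x))).
rewrite multiset.msuppE -mset_eq0 => /eqP mx; apply/esym/eqP.
by have := dm x; rewrite mx leqn0.
Qed.

Definition mdivs m : seq M := fset_set [set d | d `<=` m].

Lemma mem_mdivs d m : (d \in mdivs m) = (d `<=` m).
Proof.
rewrite /mdivs in_fset_set; last exact: finite_mdivs.
by apply/idP/idP => [/set_mem|dm]; last exact/mem_set.
Qed.

Lemma mdivs_uniq m : uniq (mdivs m).
Proof. exact: fset_uniq. Qed.

Definition ms0 : S := MSeries (fun=> 0).
Definition msopp f : S := MSeries (fun m => - mscoef f m).
Definition msadd f g : S := MSeries (fun m => mscoef f m + mscoef g m).
Definition ms1 : S := MSeries (fun m => (m == mset0)%:R).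
Definition msmul f g : S :=
  MSeries (fun m => \sum_(d \in [set d | d `<=` m])
                      mscoef f d * mscoef g (m `\` d)).
Definition msscale a f : S := MSeries (fun m => a * mscoef f m).

Lemma msaddA : associative msadd.
Proof. by move=> f g h; apply/mseriesP => m /=; rewrite addrA. Qed.
Lemma msaddC : commutative msadd.
Proof. by move=> f g; apply/mseriesP => m /=; rewrite addrC. Qed.
Lemma msadd0 : left_id ms0 msadd.
Proof. by move=> f; apply/mseriesP => m /=; rewrite add0r. Qed.
Lemma msaddN : left_inverse ms0 msopp msadd.
Proof. by move=> f; apply/mseriesP => m /=; rewrite addNr. Qed.

HB.instance Definition _ :=
  GRing.isZmodule.Build S msaddA msaddC msadd0 msaddN.

Lemma msmulE f g m :
  mscoef (msmul f g) m = \sum_(d <- mdivs m) mscoef f d * mscoef g (m `\` d).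
Proof. by rewrite /= fsbig_finite //; exact: finite_mdivs. Qed.

Lemma msmulC : commutative msmul.
Proof.
move=> f g; apply/mseriesP => m; rewrite !msmulE.
have msubBl d : m `\` d `<=` m.
  by apply/msubsetP => x; rewrite !(msetE2, mset0E) leq_subr.
have pm : perm_eq (mdivs m) [seq m `\` d | d <- mdivs m].
  apply: uniq_perm; first exact: mdivs_uniq.
    rewrite map_inj_in_uniq ?mdivs_uniq // => d e.
    by rewrite !mem_mdivs => dm em /(congr1 (fun u => m `\` u)); rewrite !msetBBK.
  move=> d; rewrite mem_mdivs; apply/idP/mapP => [dm|[e _ ->] //].
  by exists (m `\` d); rewrite ?mem_mdivs ?msubBl ?msetBBK.
rewrite (perm_big _ pm) big_map /= big_seq [RHS]big_seq.
by apply: eq_bigr => d; rewrite mem_mdivs => dm; rewrite msetBBK // mulrC.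
Qed.

Lemma msmulA : associative msmul.
Proof.
move=> f g h; apply/mseriesP => m; rewrite !msmulE.
under eq_bigr do rewrite msmulE big_distrr /=.
under [RHS]eq_bigr do rewrite msmulE big_distrl /=.
transitivity (\sum_(u <- [seq (d, e) | d <- mdivs m, e <- mdivs (m `\` d)])
   mscoef f u.1 * (mscoef g u.2 * mscoef h (m `\` u.1 `\` u.2))).
  by rewrite big_allpairs_dep.
transitivity (\sum_(u <- [seq (d, e) | d <- mdivs m, e <- mdivs d])
   mscoef f u.2 * mscoef g (u.1 `\` u.2) * mscoef h (m `\` u.1)); last first.
  by rewrite big_allpairs_dep.
pose th (u : M * M) := (u.1 `+` u.2, u.1).
have inj_th : injective th.
  move=> [d e] [d' e'] [] /[swap] -> /(congr1 (fun u => u `\` d')).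
  by rewrite !msetDKB => ->.
have unD n (F : M -> seq M) : (forall d, uniq (F d)) ->
    uniq [seq (d, e) | d <- mdivs n, e <- F d].
  move=> uF; apply: allpairs_uniq_dep => //; first exact: mdivs_uniq.
  by move=> [d e] [d' e'] _ _ /= [-> ->].
have pm : perm_eq [seq (d, e) | d <- mdivs m, e <- mdivs d]
    (map th [seq (d, e) | d <- mdivs m, e <- mdivs (m `\` d)]).
  apply: uniq_perm.
  - by apply: unD => d; exact: mdivs_uniq.
  - by rewrite (map_inj_uniq inj_th); apply: unD => d; exact: mdivs_uniq.
  move=> [d e]; apply/allpairsPdep/mapP => /=.
    move=> [d' [e' []]]; rewrite !mem_mdivs => dm ed [-> ->].
    exists (e', d' `\` e'); last by rewrite /th /= msetBDKC.
    apply/allpairsPdep; exists e', (d' `\` e'); rewrite !mem_mdivs; split=> //.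
      exact: msubset_trans dm.
    apply/msubsetP => x; rewrite !(msetE2, mset0E) leq_sub2r //; exact: (msubsetP dm).
  move=> [_ /allpairsPdep[d' [e' []]] /[!mem_mdivs] dm em -> [-> ->]].
  exists (d' `+` e'), d'; rewrite !mem_mdivs; split=> //.
    rewrite -(msetBDKC dm); exact: msetDS.
  by apply/msubsetP => x; rewrite !(msetE2, mset0E) leq_addr.
rewrite (perm_big _ pm) big_map; apply: eq_bigr => -[d e] _ /=.
rewrite mulrA msetDKB; congr (_ * _ * mscoef h _).
by apply/msetP => x; rewrite !(msetE2, mset0E) subnDA.
Qed.

Lemma msmul1 : left_id ms1 msmul.
Proof.
move=> f; apply/mseriesP => m; rewrite msmulE (bigD1_seq mset0) ?mdivs_uniq //=;
  last by rewrite mem_mdivs msub0set.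
rewrite eqxx mul1r big1 => [|d /negPf->]; last by rewrite mul0r.
by rewrite addr0; congr mscoef; apply/msetP => x; rewrite !(msetE2, mset0E) subn0.
Qed.

Lemma msmulDl : left_distributive msmul msadd.
Proof.
move=> f g h; apply/mseriesP => m.
change (mscoef (msmul (msadd f g) h) m
  = mscoef (msmul f h) m + mscoef (msmul g h) m).
by rewrite !msmulE -big_split; apply: eq_bigr => d _; rewrite /= mulrDl.
Qed.

Lemma ms1_neq0 : ms1 != 0 :> S.
Proof.
apply/eqP => /(congr1 (fun f => mscoef f mset0)) /eqP /=.
by rewrite eqxx oner_eq0.
Qed.

HB.instance Definition _ :=
  GRing.Zmodule_isComNzRing.Build S msmulA msmulC msmul1 msmulDl ms1_neq0.

Lemma msscaleA a b f : msscale a (msscale b f) = msscale (a * b) f.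
Proof. by apply/mseriesP => m /=; rewrite mulrA. Qed.
Lemma msscale1 : left_id 1 msscale.
Proof. by move=> f; apply/mseriesP => m /=; rewrite mul1r. Qed.
Lemma msscaleDr : right_distributive msscale +%R.
Proof. by move=> a f g; apply/mseriesP => m /=; rewrite mulrDr. Qed.
Lemma msscaleDl f : {morph msscale^~ f : a b / a + b}.
Proof. by move=> a b; apply/mseriesP => m /=; rewrite mulrDl. Qed.

HB.instance Definition _ := GRing.Zmodule_isLmodule.Build R S
  msscaleA msscale1 msscaleDr msscaleDl.

Lemma msscaleAl a f g : a *: (f * g) = (a *: f) * g.
Proof.
apply/mseriesP => m; rewrite [RHS]msmulE.
change (a * mscoef (msmul f g) m
  = \sum_(d <- mdivs m) (a * mscoef f d) * mscoef g (m `\` d)).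
by rewrite msmulE big_distrr; apply: eq_bigr => d _; rewrite /= mulrA.
Qed.

HB.instance Definition _ := GRing.Lmodule_isLalgebra.Build R S msscaleAl.
HB.instance Definition _ := GRing.Lalgebra_isComAlgebra.Build R S.

Definition msmonom m : S := MSeries (fun m' => (m' == m)%:R).
Definition msvar (x : I) : S := msmonom [mset x].

Lemma msmonomD d e : msmonom (d `+` e) = msmonom d * msmonom e.
Proof.
apply/mseriesP => m; rewrite [RHS]msmulE /=.
have [->|ne] := eqVneq m (d `+` e).
  rewrite (bigD1_seq d) ?mdivs_uniq //=; last first.
    by rewrite mem_mdivs; apply/msubsetP => x; rewrite !(msetE2, mset0E) leq_addr.
  rewrite eqxx msetDKB eqxx mul1r big1 ?addr0 // => d' /negPf->.
  by rewrite mul0r.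
rewrite big_seq big1 // => d'; rewrite mem_mdivs => dm.
have [dd|] := eqVneq d' d; last by rewrite mul0r.
have [ee|] := eqVneq (m `\` d') e; last by rewrite mulr0.
by case/eqP: ne; rewrite -ee -dd msetBDKC.
Qed.

End MSeriesRing.

Arguments msmul : simpl never.

Notation pqseries C := (mseries (nat + nat)%type C).

(* The two families p and q.  The indeterminates p_i and q_i (i >= 1) are
   indexed by the natural number i - 1: only the order of the positive integers
   matters below. *)
Definition pvar {C : comNzRingType} (i : nat) : pqseries C :=
  msvar (inl i).
Definition qvar {C : comNzRingType} (i : nat) : pqseries C :=
  msvar (inr i).

Section StanleyFeray.
Variables (C : comNzRingType) (k : nat).
Implicit Types (tau taub sigma : 'S_k).

Definition orbits tau := {c : {set 'I_k} | c \in porbits tau}.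

Definition colouring tau taub := {ffun orbits tau + orbits taub -> nat}.

Definition admissible tau taub : set (colouring tau taub) :=
  [set psi | forall (w : orbits tau) (b : orbits taub),
     ~~ [disjoint val w & val b] -> (psi (inl w) <= psi (inr b))%N].

Definition colour_monomial tau taub (psi : colouring tau taub) :
    pqseries C :=
  (\prod_(w : orbits tau) pvar (psi (inl w))) *
  (\prod_(b : orbits taub) qvar (psi (inr b))).

(* The sum over the infinite set of admissible functions is taken
   coefficientwise; finite_colour_monomial below shows that only finitely many
   terms contribute to a given coefficient. *)
Definition Nseries tau taub : pqseries C :=
  MSeries (fun m => \sum_(psi \in @admissible tau taub)
                      mscoef (colour_monomial psi) m).

Lemma finite_colour_monomial tau taub m :
  finite_set [set psi : colouring tau taub | mscoef (colour_monomial psi) m != 0].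
Proof.
have prodE (J : finType) (v : J -> (nat + nat)%type) :
    \prod_(z : J) msvar (v z) =
    msmonom (\big[msetD/mset0]_(z : J) [mset v z]) :> mseries _ C.
  by elim/big_rec2: _ => // z s m' _ ->; rewrite -msmonomD.
have memD (J : finType) (v : J -> (nat + nat)%type) z :
    v z \in \big[msetD/mset0]_(z : J) [mset v z].
  have : z \in index_enum J by exact: mem_index_enum.
  elim: (index_enum J) => // y s IH; rewrite in_cons big_cons in_msetD.
  by case/orP => [/eqP <-|/IH ->]; rewrite ?in_mset1 ?eqxx ?orbT.
pose wt (x : (nat + nat)%type) : nat := match x with inl i => i | inr i => i end.
set B := (\max_(x <- m) wt x)%N.
pose g (u : {ffun orbits tau + orbits taub -> 'I_B.+1}) : colouring tau taub :=
  [ffun z => val (u z)].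
apply: (@sub_finite_set _ _ (g @` setT)); last exact/finite_image/finite_finset.
move=> psi; rewrite /mkset /colour_monomial /pvar /qvar !prodE -msmonomD /=.
case: (eqVneq m) => [mE _|_]; last by rewrite eqxx.
have bnd z : (psi z < B.+1)%N.
  have inm x : x \in m -> (wt x <= B)%N.
    by move=> xm; rewrite /B (big_rem x) //= leq_maxl.
  rewrite ltnS; case: z => z.
    by apply: (inm (inl _)); rewrite mE in_msetD (memD _ (fun w => inl _)).
  apply: (inm (inr _)); rewrite mE in_msetD.
  by rewrite (memD _ (fun w => inr (psi (inr w)))) orbT.
exists [ffun z => inord (psi z)] => //.
by apply/ffunP => z; rewrite !ffunE /= inordK.
Qed.

(* In mathcomp, (tau * taub) x = taub (tau x).  With the opposite convention
   for products the sums below are the same: replace each pair by the pair of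
   inverses and conjugate it by a permutation taking sigma^-1 to sigma; this
   does not change the orbits, up to a relabelling of the points. *)
Definition Sigma' sigma : pqseries C :=
  \sum_(tau : 'S_k) \sum_(taub : 'S_k |
      (tau * taub == sigma)%g &&
      [transitive <<[set tau; taub]%SET>>, on [set: 'I_k]%SET | 'P]%g)
    (-1) ^+ #|porbits tau|.+1 * Nseries tau taub.

Definition has_cycle_type sigma (mu : seq nat) : bool :=
  perm_eq [seq #|c| | c : {set 'I_k} in porbits sigma] mu.

End StanleyFeray.

Definition long_cycle (l : nat) : 'S_l := perm (@ordS_inj l).

(* free_cumulant C j is R_j, for j >= 2. *)
Definition free_cumulant (C : comNzRingType) (j : nat) :
    pqseries C :=
  let l := j.-1 in
  \sum_(tau : 'S_l) \sum_(taub : 'S_l |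
      (tau * taub == long_cycle l)%g &&
      (#|porbits tau| + #|porbits taub| == l.+1)%N)
    (-1) ^+ #|porbits tau|.+1 * Nseries C tau taub.

(* The variable 'X_i (i < k) of K stands for R_{i+2}. *)
Definition eval_free_cumulants (C : comNzRingType) (k : nat)
    (K : {mpoly C[k]}) : pqseries C :=
  mmap (in_alg _) (fun i : 'I_k => free_cumulant C i.+2) K.

(* K is "the" polynomial K'_mu: unique since the free cumulants are
   algebraically independent; Sigma' only depends on the cycle type of sigma. *)
Definition is_Kprime (C : comNzRingType) (k : nat) (mu : seq nat)
    (K : {mpoly C[k]}) : Prop :=
  exists2 sigma : 'S_k, has_cycle_type sigma mu &
    Sigma' C sigma = eval_free_cumulants K.

(* The exponent vector of the monomial R_{j_1} ... R_{j_t}. *)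
Definition cumulant_monomial (k : nat) (j : seq nat) : 'X_{1..k} :=
  [multinom count_mem i.+2 j | i < k].

Definition nsolutions (t : nat) (l : 'I_t -> nat) (L : int) : nat :=
  #|[set x : {dffun forall i : 'I_t, 'I_(l i).+1}
       | \sum_(i < t) (x i)%:Z == L]%SET|.

(* Main.v *)
(* A pair (tau, taub) of product sigma is a bipartite map: edges are the points,
   white and black vertices the orbits of tau and taub, faces the orbits of sigma.
   The part of graded degree r + s of Sigma' comes from planar maps with two faces,
   of lengths r and s, whose graph has a single loop. Let X be the set of edges of
   the loop oriented from white to black when going around it in a fixed direction.
   A colouring satisfying the inequalities of all edges outside X satisfies one in
   X, so the alternating sum over E <= X of the series N of the map without E
   vanishes. Hence N of the map is a signed sum over nonempty E; deleting E leaves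
   a cyclic chain of |E| plane trees, and summing over these trees produces free
   cumulants. A tree with j - 1 edges meets the two faces in a and b edges (counting
   the deleted edge that follows it) with a + b = j, and the two faces can be rooted
   in r s ways, so that the top part of Sigma' is
     sum_t (r s / t) sum_{a, b} R_{a_1 + b_1} ... R_{a_t + b_t},
   over a_i, b_i >= 1 with sum a_i = r and sum b_i = s.
   Algebraic independence of the R_j then identifies the coefficients. *)

(* Planarity enters only through lengths: when s is one cycle on all points, [geodesic s a] says
   that a and a^-1 s form a plane tree, and deleting an edge is a multiplication by transpositions.
   A deleted edge remains as a fixed point and the set of edges still present is carried separately,
   so that all maps live on one type. Pairs that are not transitive (a tree beside a map of genus 1)
   can have as many orbits as the annular ones; they drop out because they have no crossing edge.
   The sum over E is expanded along the contour of one face: each deletion breaks a contour word in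
   two, and the outcome depends on four lengths only. The predecessor of the first deleted edge can
   be chosen in r ways. The place of that edge in its link turns the generating polynomial F of a
   link into x F', and F^t x F' = x (F^(t+1))' / (t+1) yields s / (t+1). All sums use finitely many
   colours, with weights in an arbitrary commutative ring: truncating the series gives identities
   between such sums, and these are enough to determine the top part of K'. *)
From HB Require Import structures.
Require Import Defs.
From mathcomp Require Import all_boot all_order all_algebra all_fingroup.
From mathcomp Require Import mpoly zify.
From mathcomp Require boolp.

Set Implicit Arguments.
Unset Strict Implicit.
Unset Printing Implicit Defensive.

Import GroupScope Order.TTheory GRing.Theory Num.Theory.

(** * Lengths of permutations and products of disjoint cycles *)

Section Length.
Variable T : finType.
Implicit Types (s a b : {perm T}) (x y : T) (D : {set T}).

Definition nporb s := #|porbits s|.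
(** The least number of transpositions with product [s]. The excess of [plen a + plen b] over
    [plen (a * b)] is what measures genus and connectedness below. *)
Definition plen s := #|T| - nporb s.

Lemma plenK s : plen s + nporb s = #|T|.
Proof.
by rewrite /plen subnK // (leq_trans (leq_imset_card _ _)) ?max_card.
Qed.

Lemma nporb_tperm s x y :
  nporb (tperm x y * s) + (x \notin porbit s y).*2 = nporb s + (x != y).
Proof. exact: porbits_mul_tperm. Qed.

Lemma plen_tperm_out s x y : x \notin porbit s y ->
  plen (tperm x y * s) = (plen s).+1.
Proof.
move=> xy; have := nporb_tperm s x y; rewrite xy.
have ->: x != y by apply: contraNneq xy => ->; exact: porbit_id.
move: (plenK s) (plenK (tperm x y * s)) => /=; lia.
Qed.

Lemma plen_tperm_in s x y : x != y -> x \in porbit s y ->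
  plen s = (plen (tperm x y * s)).+1.
Proof.
move=> ne xy; have := nporb_tperm s x y; rewrite xy ne.
move: (plenK s) (plenK (tperm x y * s)) => /=; lia.
Qed.

Lemma plen_tperm_le s x y : plen (tperm x y * s) <= (plen s).+1.
Proof.
have [->|ne] := eqVneq x y; first by rewrite tperm1 mul1g.
have [/(plen_tperm_in ne)->|/plen_tperm_out->//] := boolP (x \in porbit s y).
exact: leqW.
Qed.

Lemma mem_porbit1 s x : s x \in porbit s x.
Proof. by have := mem_porbit s 1 x; rewrite expg1. Qed.

(** The transposition on the left turns [s x] into a fixed point; on the right, in [plen_moveV], it
    does so to [x]. *)
Lemma plen_move s x : s x != x -> plen s = (plen (tperm x (s x) * s)).+1.
Proof.
by move=> sx; apply: plen_tperm_in; rewrite 1?eq_sym // porbit_sym mem_porbit1.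
Qed.

Lemma plen1 : plen 1 = 0.
Proof.
rewrite /plen; suff ->: nporb 1 = #|T| by rewrite subnn.
apply: card_imset => x y.
by move/eqP; rewrite eq_porbit_mem => /porbitP[i]; rewrite expg1n perm1.
Qed.

Lemma plen_ind (P : {perm T} -> Prop) : P 1 ->
    (forall s x, s x != x -> P (tperm x (s x) * s) -> P s) ->
  forall s, P s.
Proof.
move=> P1 PS s; have [n] := ubnP (plen s); elim: n s => // n IH s.
have [/existsP[x sx]|] := boolP [exists x, s x != x].
  by rewrite (plen_move sx) ltnS => /IH; exact: PS.
rewrite negb_exists => /forallP s1 _; suff ->: s = 1 by [].
by apply/permP => x; rewrite perm1; apply/eqP/negPn/s1.
Qed.

Lemma plen_mul_le a b : plen (a * b) <= plen a + plen b.
Proof.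
elim/plen_ind: a => [|a x ax IH]; first by rewrite mul1g plen1.
rewrite (plen_move ax) addSn -ltnS.
apply: leq_trans (_ : (plen (tperm x (a x) * a * b)).+2 <= _); last by [].
by rewrite ltnS -{1}[a](mulKg (tperm x (a x))) tpermV -!mulgA plen_tperm_le.
Qed.

Lemma plenV s : plen s^-1 = plen s.
Proof. by rewrite /plen /nporb porbitsV. Qed.

Lemma plen_moveV s x : s x != x -> plen s = (plen (s * tperm x (s x))).+1.
Proof.
move=> sx; rewrite -[in RHS]plenV invMg tpermV tpermC -[X in tperm _ X](permK s x).
by rewrite -plen_move ?plenV // permK eq_sym.
Qed.

(* Splitting off x -> a x would otherwise merge two orbits of a * b, making the
   triangle inequality strict. *)
Lemma geodesic_porbit a b x : plen (a * b) = plen a + plen b ->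
  a x \in porbit (a * b) x.
Proof.
move=> ab; have [->|ax] := eqVneq (a x) x; first exact: porbit_id.
rewrite porbit_sym; apply/negPn/negP => /plen_tperm_out.
rewrite ab mulgA (plen_move ax) => e.
by have := plen_mul_le (tperm x (a x) * a) b; rewrite e; lia.
Qed.

Lemma porbit_sub s D x : s @: D \subset D -> x \in D -> porbit s x \subset D.
Proof.
move=> sD xD; apply/subsetP => _ /porbitP[i ->].
elim: i => [|i IH]; first by rewrite perm1.
by rewrite expgSr permM (subsetP sD) // imset_f.
Qed.

Lemma porbit_fix s x : s x = x -> porbit s x = [set x].
Proof.
move=> sx; apply/eqP; rewrite eqEsubset sub1set porbit_id andbT.
by apply: porbit_sub; rewrite ?inE // imset_set1 sx.
Qed.

Lemma plen_disjoint D1 D2 a b : perm_on D1 a -> perm_on D2 b ->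
  [disjoint D1 & D2] -> plen (a * b) = plen a + plen b.
Proof.
move=> aD bD dis; elim/plen_ind: a aD => [|a x ax IH] aD.
  by rewrite mul1g plen1.
have xD : x \in D1 by apply: contraR ax => /(out_perm aD)->.
have axD : a x \in D1 by rewrite (perm_closed _ aD).
rewrite (plen_move ax) addSn -IH; last first.
  apply: perm_onM aD; apply: subset_trans (tperm_on _ _) _.
  by rewrite subUset !sub1set xD axD.
(* [a x] is fixed by the shortened product, since [b] does not move it; putting it back merges two
   orbits. *)
rewrite -(@plen_tperm_out _ x (a x)) ?mulgA ?tperm2 ?mul1g //.
rewrite porbit_fix ?inE 1?eq_sym // !permM tpermR (out_perm bD) //.
by rewrite (disjointFr dis axD).
Qed.

End Length.

(** * Cycles written as words *)

Section Cycles.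
Variable T : finType.
Implicit Types (s : {perm T}) (x y z : T) (l : seq T).

(** A star of transpositions centred at the first letter: products act from left to right, so cycles
    with a common first letter multiply by concatenation of words ([pcycle_cat]). *)
Fixpoint cycle_from x l : {perm T} :=
  if l is y :: l' then tperm x y * cycle_from x l' else 1.

Definition pcycle l : {perm T} := if l is x :: l' then cycle_from x l' else 1.

Arguments pcycle : simpl never.

Lemma pcycle2 x y l : pcycle [:: x, y & l] = tperm x y * pcycle (x :: l).
Proof. by []. Qed.

Lemma pcycle_cat x l1 l2 :
  pcycle (x :: l1 ++ l2) = pcycle (x :: l1) * pcycle (x :: l2).
Proof. by elim: l1 => [|y l1 IH]; rewrite ?mul1g // cat_cons 2!pcycle2 IH mulgA. Qed.

Lemma pcycle_on l : perm_on [set x in l] (pcycle l).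
Proof.
case: l => [|x l]; first exact: perm_on1.
elim: l => [|y l IH]; first exact: perm_on1.
rewrite pcycle2; apply: perm_onM; last apply: subset_trans IH _.
  apply: subset_trans (tperm_on _ _) _; apply/subsetP => z.
  by rewrite !inE; case/orP=> ->; rewrite ?orbT.
by apply/subsetP => z; rewrite !inE => /orP[]->; rewrite ?orbT.
Qed.

Lemma pcycle_out l x : x \notin l -> pcycle l x = x.
Proof. by move=> xl; rewrite (out_perm (pcycle_on l)) // inE. Qed.

Lemma tperm_comm x y s : s x = x -> s y = y -> tperm x y * s = s * tperm x y.
Proof. by move=> sx sy; rewrite conjgC tpermJ sx sy. Qed.

Lemma tperm_pcycle x y l : x \notin l -> y \notin l ->
  tperm x y * pcycle (x :: l) = pcycle (y :: l) * tperm x y.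
Proof.
elim: l => [|z l IH]; first by rewrite /pcycle /= mulg1 mul1g.
rewrite !inE !negb_or => /andP[xz xl] /andP[yz yl]; rewrite !pcycle2 -mulgA.
rewrite -IH // !mulgA; congr (_ * _).
by rewrite [RHS]conjgC tpermJ tpermR tpermD.
Qed.

Lemma pcycle_rcons x l : uniq (x :: l) -> pcycle (rcons l x) = pcycle (x :: l).
Proof.
case: l => // y l; rewrite !cons_uniq inE negb_or => /and3P[/andP[xy xl] yl ul].
rewrite -cats1 pcycle2 tperm_pcycle //.
by rewrite cat_cons pcycle_cat pcycle2 /= mulg1 tpermC.
Qed.

Lemma pcycle_catC l1 l2 : uniq (l1 ++ l2) -> pcycle (l1 ++ l2) = pcycle (l2 ++ l1).
Proof.
elim: l1 l2 => [|x l1 IH] l2; first by rewrite cats0.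
move=> u; rewrite cat_cons -pcycle_rcons // -cats1 -catA IH; last first.
  by move: u; rewrite catA cats1 -rot1_cons rot_uniq.
by rewrite -catA.
Qed.

Lemma pcycle_next x y l : uniq [:: x, y & l] -> pcycle [:: x, y & l] x = y.
Proof.
rewrite !cons_uniq => /and3P[xl yl _]; rewrite pcycle2 permM tpermL.
by apply: pcycle_out; move: xl; rewrite !inE eq_sym !negb_or => /andP[->].
Qed.

Lemma pcycle_nth x0 l i : uniq l -> i < size l ->
  pcycle l (nth x0 l i) = nth x0 l (i.+1 %% size l).
Proof.
move=> ul il; rewrite -{1}(cat_take_drop i l) pcycle_catC ?cat_take_drop //.
have ur : uniq (drop i l ++ take i l) by rewrite -[_ ++ _]/(rot i l) rot_uniq.
have [e|ne] := eqVneq i.+1 (size l).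
  rewrite e modnn; move: ur; rewrite (drop_nth x0) // drop_oversize ?e //.
  case: l il ul e => // y [|z l] il ul e /=; first by move: e => [->]; rewrite perm1.
  move: e il => [->] il /= u. rewrite [take _ _]/= pcycle_next //.
have il' : i.+1 < size l by lia.
rewrite modn_small //; move: ur; rewrite (drop_nth x0) // (drop_nth x0) //.
exact: pcycle_next.
Qed.

Lemma plen_pcycle l : uniq l -> plen (pcycle l) = (size l).-1.
Proof.
case: l => [|x l]; first by rewrite plen1.
elim: l => [|y l IH]; first by rewrite plen1.
move=> /= /and3P[xl yl ul]; rewrite pcycle2.
move: xl; rewrite inE negb_or => /andP[xy xl].
rewrite plen_tperm_out ?IH //= ?xl // porbit_fix ?inE //.
by rewrite (@pcycle_out (x :: l)) // inE negb_or eq_sym xy.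
Qed.

(** The effect on the contour of deleting an edge [e] of a plane tree, where [g] precedes [e] at its
    white vertex and [z] follows [g] on the contour: the tree falls apart into two. *)
Lemma pcycle_split g e z l1 l2 : uniq (g :: z :: l1 ++ e :: l2) ->
  tperm g e * pcycle (g :: z :: l1 ++ e :: l2) * tperm e z =
  pcycle (z :: l1) * pcycle (g :: l2).
Proof.
move=> /= /and3P[]; rewrite inE mem_cat !inE !negb_or mem_cat inE cat_uniq /=.
move=> /and3P[gz gl1 /andP[ge gl2]].
rewrite !negb_or => /and3P[zl1 ze zl2] /and3P[ul1 /andP[el1 _] /andP[el2 ul2]].
rewrite -(cat_cons z l1 (e :: l2)) pcycle_cat (pcycle2 g e) -pcycle_rcons; last first.
  by rewrite /= inE negb_or gz gl1 zl1.
rewrite -cats1 cat_cons pcycle_cat pcycle2 mulg1 -!mulgA.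
rewrite -(@tperm_comm e z (pcycle (g :: l2))); first last.
- by rewrite pcycle_out // inE negb_or eq_sym gz.
- by rewrite pcycle_out // inE negb_or eq_sym ge.
rewrite mulgA (@tperm_comm g e (pcycle (z :: l1))); first last.
- by rewrite pcycle_out // inE negb_or eq_sym ze.
- by rewrite pcycle_out // inE negb_or gz.
rewrite !mulgA; congr (_ * _); rewrite -!mulgA -[RHS]mulg1; congr (_ * _).
rewrite mulgA mulgA -(mulgA (tperm g e) (tperm z g)) [tperm z g * _]conjgC.
rewrite tpermJ tpermL (tpermD gz) 1?eq_sym // mulgA tperm2 mul1g.
by rewrite tpermC tperm2.
Qed.

(** The same deletion when [g] and [e] lie on different faces: the two contours join into one. *)
Lemma pcycle_merge g e l1 l2 : uniq (e :: l1 ++ g :: l2) ->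
  tperm g e * (pcycle (e :: l1) * pcycle (g :: l2))
    * tperm e (pcycle (g :: l2) g) = pcycle (g :: l1 ++ l2).
Proof.
rewrite /= mem_cat inE cat_uniq /= !negb_or.
move=> /and4P[/and3P[el1 eg el2] ul1 /andP[gl1 _] /andP[gl2 _]].
set b := pcycle (g :: l2); rewrite -!mulgA.
have be : b e = e by rewrite pcycle_out // inE negb_or eg.
rewrite -{3}be -tpermJ -conjgC mulgA (tpermC g e) tperm_pcycle // -!mulgA.
by rewrite (mulgA (tperm e g)) tperm2 mul1g -pcycle_cat.
Qed.

End Cycles.

(** * Geodesic permutations and the removal of a point *)

Section Geodesics.
Variable T : finType.
Implicit Types (s a b : {perm T}) (x y : T) (D : {set T}).

(** For [s] a cycle on all points these are the noncrossing permutations; with [a^-1 * s] they are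
    the two vertex rotations of a plane tree with contour [s]. *)
Definition geodesic s a := plen a + plen (a^-1 * s) == plen s.

Lemma geodesic_mem s a : geodesic s a -> forall x, a x \in porbit s x.
Proof.
move/eqP => e x; have -> : s = a * (a^-1 * s) by rewrite mulKVg.
by apply: geodesic_porbit; rewrite mulKVg.
Qed.

Lemma geodesic_fix s a x : geodesic s a -> s x = x -> a x = x.
Proof.
by move=> /geodesic_mem/(_ x) ax /porbit_fix sx; move: ax; rewrite sx inE => /eqP.
Qed.

Lemma geodesic_on s a D : geodesic s a -> perm_on D s -> perm_on D a.
Proof.
move=> ga sD; apply/subsetP => x; rewrite inE; apply: contraR => xD.
by apply/eqP/(geodesic_fix ga); rewrite (out_perm sD).
Qed.

Lemma porbit_on s D x : perm_on D s -> x \in D -> porbit s x \subset D.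
Proof. by move=> sD; apply: porbit_sub; rewrite im_perm_on. Qed.

Lemma expg_mul_on a b D1 D2 x i : perm_on D1 a -> perm_on D2 b ->
  [disjoint D1 & D2] -> x \in D1 -> ((a * b) ^+ i) x = (a ^+ i) x.
Proof.
move=> aD bD dis xD.
suff [] : ((a * b) ^+ i) x = (a ^+ i) x /\ (a ^+ i) x \in D1 by [].
elim: i => [|i [IH iD]]; first by rewrite !expg0 !perm1.
rewrite !expgSr !permM IH (out_perm bD); first by rewrite (perm_closed _ aD).
by rewrite (disjointFr dis) // (perm_closed _ aD).
Qed.

Lemma porbit_mul_on a b D1 D2 x : perm_on D1 a -> perm_on D2 b ->
  [disjoint D1 & D2] -> x \in D1 -> porbit (a * b) x = porbit a x.
Proof.
move=> aD bD dis xD; apply/porbit_setP => y.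
by apply/porbitP/porbitP => -[i ->]; exists i; rewrite (expg_mul_on _ aD bD).
Qed.

(** Lengths add over disjoint supports, so two triangle inequalities are summed; equality in the sum
    forces it in both. *)
Lemma geodesic_mul a1 a2 s1 s2 D1 D2 : perm_on D1 a1 -> perm_on D1 s1 ->
  perm_on D2 a2 -> perm_on D2 s2 -> [disjoint D1 & D2] ->
  geodesic (s1 * s2) (a1 * a2) = geodesic s1 a1 && geodesic s2 a2.
Proof.
move=> a1D s1D a2D s2D dis; rewrite /geodesic.
have b1D := perm_onM (perm_onV a1D) s1D; have b2D := perm_onM (perm_onV a2D) s2D.
have -> : (a1 * a2)^-1 * (s1 * s2) = (a1^-1 * s1) * (a2^-1 * s2).
  by rewrite invMg !mulgA -(mulgA a2^-1) (perm_onC b1D (perm_onV a2D) dis).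
rewrite (plen_disjoint a1D a2D) // (plen_disjoint b1D b2D) // (plen_disjoint s1D s2D) //.
have := plen_mul_le a1 (a1^-1 * s1); have := plen_mul_le a2 (a2^-1 * s2).
rewrite !mulKVg; move: (plen _) (plen _) (plen _) (plen _) (plen _) (plen _).
by lia.
Qed.

Lemma restr_perm_mul a D1 D2 : perm_on (D1 :|: D2) a ->
  {in D1, forall x, a x \in D1} -> {in D2, forall x, a x \in D2} ->
  [disjoint D1 & D2] -> restr_perm D1 a * restr_perm D2 a = a.
Proof.
move=> aD a1 a2 dis.
have N D : {in D, forall x, a x \in D} -> a \in 'N(D | 'P).
  move=> h; rewrite !inE; apply/andP; split => //.
  by apply/subsetP => x xD; rewrite inE /=; apply: h.
apply/permP => x; rewrite permM.
have [x1|x1] := boolP (x \in D1).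
  rewrite (restr_permE (N _ a1) x1) (out_perm (restr_perm_on D2 a)) //.
  by rewrite (disjointFr dis) // a1.
rewrite (out_perm (restr_perm_on D1 a)) //.
have [x2|x2] := boolP (x \in D2); first by rewrite (restr_permE (N _ a2) x2).
rewrite (out_perm (restr_perm_on D2 a)) // (out_perm aD) //.
by rewrite inE negb_or x1.
Qed.

Lemma restr_perm_mulE a1 a2 D1 D2 : perm_on D1 a1 -> perm_on D2 a2 ->
  [disjoint D1 & D2] -> restr_perm D1 (a1 * a2) = a1.
Proof.
move=> a1D a2D dis.
have e x : x \in D1 -> (a1 * a2) x = a1 x.
  move=> xD; rewrite permM (out_perm a2D) // (disjointFr dis) //.
  by rewrite (perm_closed _ a1D).
apply/permP => x; have [x1|x1] := boolP (x \in D1); last first.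
  by rewrite (out_perm (restr_perm_on D1 _)) // (out_perm a1D).
rewrite restr_permE ?e //; rewrite !inE; apply/andP; split => //.
by apply/subsetP => y yD; rewrite inE /= /aperm e // (perm_closed _ a1D).
Qed.

(** By [geodesic_mem] a geodesic preserves both supports, so restriction to them inverts
    multiplication. *)
Lemma sum_geodesic_mul (A : zmodType) s1 s2 D1 D2 (F : {perm T} -> A) :
  perm_on D1 s1 -> perm_on D2 s2 -> [disjoint D1 & D2] ->
  (\sum_(a | geodesic (s1 * s2)%g a) F a =
   \sum_(a1 | geodesic s1 a1) \sum_(a2 | geodesic s2 a2) F (a1 * a2)%g)%R.
Proof.
move=> s1D s2D dis; rewrite pair_big /=.
have dis' : [disjoint D2 & D1] by rewrite disjoint_sym.
have s12 : s1 * s2 = s2 * s1 by rewrite (perm_onC s1D s2D dis).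
have U1 : {subset D1 <= D1 :|: D2} by move=> x; rewrite inE => ->.
have U2 : {subset D2 <= D1 :|: D2} by move=> x; rewrite inE orbC => ->.
pose h (c : {perm T} * {perm T}) := c.1 * c.2.
rewrite (reindex_onto h (fun a => (restr_perm D1 a, restr_perm D2 a))) /=.
  apply: eq_bigl => -[a1 a2] /=; rewrite /h /=; apply/andP/andP.
    case=> ga /eqP[e1 e2]; apply/andP.
    have a1D : perm_on D1 a1 by rewrite -e1 restr_perm_on.
    have a2D : perm_on D2 a2 by rewrite -e2 restr_perm_on.
    by rewrite -(geodesic_mul a1D s1D a2D s2D dis).
  case=> g1 g2; have a1D := geodesic_on g1 s1D; have a2D := geodesic_on g2 s2D.
  rewrite (geodesic_mul a1D s1D a2D s2D) // g1 g2; split=> //.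
  rewrite (restr_perm_mulE a1D a2D) // (perm_onC a1D a2D) //.
  by rewrite (restr_perm_mulE a2D a1D).
move=> a ga; apply: restr_perm_mul => //.
- apply: geodesic_on ga _; apply: perm_onM.
    exact: subset_trans s1D (subsetUl _ _).
  exact: subset_trans s2D (subsetUr _ _).
- move=> x xD; have := geodesic_mem ga x; rewrite (porbit_mul_on s1D s2D) //.
  exact: (subsetP (porbit_on s1D xD)).
- move=> x xD; have := geodesic_mem ga x; rewrite s12 (porbit_mul_on s2D s1D) //.
  exact: (subsetP (porbit_on s2D xD)).
Qed.

(** [tperm g e * a] bypasses [e]: it sends [g] directly to [a e] and otherwise follows [a]. *)
Lemma porbit_del a e g x y : a g = e -> g != e -> x != e -> y != e ->
  (porbit (tperm g e * a) x == porbit (tperm g e * a) y) = (porbit a x == porbit a y).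
Proof.
move=> ag ge xe ye; rewrite !eq_porbit_mem; set a' := tperm g e * a.
have a'e : a' e = e by rewrite permM tpermR.
have a'g : a' g = a e by rewrite permM tpermL.
have a'z z : z != e -> z != g -> a' z = a z.
  by move=> ze zg; rewrite permM tpermD // eq_sym.
have a'ne z i : z != e -> (a' ^+ i) z != e.
  move=> ze; elim: i => [|i IH]; first by rewrite perm1.
  by rewrite expgSr permM -[e in _ != e]a'e (inj_eq perm_inj).
apply/porbitP/porbitP => -[i xE].
  rewrite {x xe}xE; elim: i => [|i [j IH]]; first by exists 0; rewrite !perm1.
  rewrite expgSr permM; have := a'ne y i ye; set z := (a' ^+ i) y in IH *.
  move=> ze; have [zg|zg] := eqVneq z g.
    by exists j.+2; rewrite zg a'g -ag -zg IH !expgSr !permM.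
  by exists j.+1; rewrite a'z // IH expgSr permM.
(* Along the walk of [a] from [y], the current point is either on the walk of [a'] or is [e],
   reached from a point [g] on that walk. *)
suff: (exists j, (a ^+ i) y = (a' ^+ j) y) \/
    ((a ^+ i) y = e /\ exists j, g = (a' ^+ j) y).
  by case=> [[j yE]|[yE _]]; [exists j; rewrite xE|move: xe; rewrite xE yE eqxx].
elim: i {x xe xE} => [|i IH]; first by left; exists 0; rewrite !perm1.
rewrite expgSr permM; case: IH => [[j ->]|[-> [j gE]]]; last first.
  by left; exists j.+1; rewrite expgSr permM -gE a'g.
have := a'ne y j ye; set z := (a' ^+ j) y => ze.
have [zg|zg] := eqVneq z g; first by right; rewrite zg; split=> //; exists j.
by left; exists j.+1; rewrite expgSr permM -/z a'z.
Qed.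

Lemma porbit_delV b e x y : b e != e -> x != e -> y != e ->
  (porbit (b * tperm e (b e)) x == porbit (b * tperm e (b e)) y) =
  (porbit b x == porbit b y).
Proof.
move=> be xe ye; rewrite -!(porbitV b) -!(porbitV (_ * _)).
rewrite invMg tpermV tpermC; apply: porbit_del => //; first exact: permK.
Qed.

Lemma plen_insert a e g : a e = e -> g != e ->
  plen (tperm g e * a) = (plen a).+1.
Proof.
by move=> ae ge; rewrite tpermC plen_tperm_out // porbit_sym porbit_fix // inE.
Qed.

Lemma cutK s a e g : (tperm g e * a)^-1 * s = a^-1 * (tperm g e * s).
Proof. by rewrite invMg tpermV mulgA. Qed.

(* a' = tperm g e * a removes the point e (following g) from its cycle, and
   s' is the product of the permutations obtained by removing e from a and
   from a^-1 * s. *)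
Lemma sum_cut (A : zmodType) s s' e g (F : {perm T} -> A) :
  g != e -> s g != e -> s' = tperm g e * s * tperm e (s g) -> s' e = e ->
  (\sum_(a : {perm T} | (a g == e) && (plen a + plen (a^-1 * s)%g == (plen s').+2)%N) F a =
   \sum_(a | geodesic s' a) F (tperm g e * a)%g)%R.
Proof.
move=> ge sg s'E s'e; rewrite (reindex_inj (mulgI (tperm g e))) /=.
apply: eq_bigl => a; rewrite permM tpermL.
apply/andP/idP => [[/eqP ae]|ga].
  rewrite plen_insert //; set b := _^-1 * s => h.
  (* The permutation under the sum sends [g] to [e], so its cofactor [b] sends [e] to [s g].
     Removing [e] from both factors lowers the total length by two. *)
  have be : b e = s g.
    by rewrite /b permM; congr (s _); apply: (@perm_inj _ (tperm g e * a)); rewrite permKV permM tpermL ae.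
  rewrite /geodesic; suff e1 : plen b = (plen (a^-1 * s')).+1.
    by move: h; rewrite e1 addnS addSn !eqSS.
  rewrite (@plen_moveV _ b e) be // s'E /b cutK !mulgA; congr (plen _).+1.
have ae := geodesic_fix ga s'e; rewrite ae eqxx plen_insert //; split=> //.
move: ga; set b := _^-1 * s => ga.
have be : b e = s g.
  by rewrite /b permM; congr (s _); apply: (@perm_inj _ (tperm g e * a)); rewrite permKV permM tpermL ae.
rewrite addSn (@plen_moveV _ b e) be // addnS !eqSS -(eqP ga) s'E.
by rewrite /b cutK !mulgA.
Qed.
End Geodesics.

Local Open Scope ring_scope.

(** * Colourings of bipartite graphs *)

Section Colourings.
Variables (A : comNzRingType) (m : nat).
Local Notation K := 'I_m.+1.

(** A colouring of a subset is encoded as a function on the whole type with a default colour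
    elsewhere, so that summation stays over one type. *)
Definition supp_in (X : finType) (B : {set X}) (f : {ffun X -> K}) :=
  [forall u, (u \notin B) ==> (f u == ord0)].

Lemma supp_inP (X : finType) (B : {set X}) (f : {ffun X -> K}) :
  reflect (forall u, u \notin B -> f u = ord0) (supp_in B f).
Proof.
by apply: (iffP forallP) => h u; [move=> /(implyP (h u))/eqP | apply/implyP => /h ->].
Qed.

Definition pull (T X : finType) (S : {set T}) (a : T -> X) (f : {ffun X -> K}) :
  {ffun T -> K} := [ffun x => if x \in S then f (a x) else ord0].

(** [Phi] receives the colour at the end of each edge and not the colouring of the vertices, so that
    sums over different types of vertices can be compared. *)
Definition colour_sum (T X : finType) (wt : K -> A) (S : {set T}) (a : T -> X)
    (Phi : {ffun T -> K} -> A) : A :=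
  \sum_(f | supp_in (a @: S) f) Phi (pull S a f) * \prod_(u in a @: S) wt (f u).

Definition fibre_reps (T X : finType) (S : {set T}) (a : T -> X) : {set T} :=
  [set x in S | [pick y in S | a y == a x] == Some x].

Definition fibre_const (T X : finType) (S : {set T}) (a : T -> X)
    (F : {ffun T -> K}) :=
  [forall x in S, forall y in S, (a x == a y) ==> (F x == F y)].

Lemma fibre_constP (T X : finType) (S : {set T}) (a : T -> X)
    (F : {ffun T -> K}) :
  reflect {in S &, forall x y, a x = a y -> F x = F y} (fibre_const S a F).
Proof.
apply: (iffP forall_inP) => [h x y xS yS axy|h x xS].
  by move/forall_inP: (h x xS) => /(_ y yS); rewrite axy eqxx => /eqP.
by apply/forall_inP => y yS; apply/implyP => /eqP axy; apply/eqP/h.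
Qed.

Lemma prod_fibre_reps (T X : finType) (S : {set T}) (a : T -> X) (G : X -> A) :
  \prod_(u in a @: S) G u = \prod_(x in fibre_reps S a) G (a x).
Proof.
have <- : a @: fibre_reps S a = a @: S.
  apply/eqP; rewrite eqEsubset imsetS ?subsetIl //=; last first.
    by apply/subsetP => x; rewrite inE => /andP[].
  apply/subsetP => _ /imsetP[x xS ->].
  case Ep: [pick y in S | a y == a x] => [y|]; last first.
    by move: Ep; case: pickP => // /(_ x) /=; rewrite xS eqxx.
  have /andP[yS /eqP ayx] : (y \in S) && (a y == a x).
    by move: Ep; case: pickP => // z h [<-].
  by apply/imsetP; exists y => //; rewrite inE yS ayx Ep /=.
rewrite big_imset //= => x y; rewrite !inE => /andP[_ /eqP ex] /andP[_ /eqP ey] axy.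
by apply: Some_inj; rewrite -ex -ey axy.
Qed.

(** Seen on edges alone, the vertices matter only through the partition of [S] into fibres; a
    representative edge carries the weight of its vertex. *)
Lemma colour_sum_fibre (T X : finType) wt (S : {set T}) (a : T -> X) Phi :
  colour_sum wt S a Phi =
  \sum_(F | supp_in S F && fibre_const S a F)
     Phi F * \prod_(x in fibre_reps S a) wt (F x).
Proof.
pose h (F : {ffun T -> K}) : {ffun X -> K} :=
  [ffun u => if [pick x in S | a x == u] is Some x then F x else ord0].
rewrite /colour_sum (reindex_onto h (pull S a)) /=; last first.
  move=> f /supp_inP sf; apply/ffunP => u; rewrite ffunE.
  case: pickP => [x /andP[xS /eqP <-]|none]; first by rewrite ffunE xS.
  rewrite sf //; apply/imsetP => -[x xS ux].
  by have := none x; rewrite xS ux eqxx.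
apply: eq_big => [F|F /andP[_ /eqP e]]; last first.
  rewrite e prod_fibre_reps; congr (_ * _); apply: eq_bigr => x.
  rewrite inE => /andP[xS _]; congr wt.
  by move/ffunP/(_ x): e; rewrite ffunE xS.
apply/andP/andP => [[_ /eqP <-]|[/supp_inP sF /fibre_constP cF]]; split.
- by apply/supp_inP => x /negPf xS; rewrite ffunE xS.
- by apply/fibre_constP => x y xS yS axy; rewrite !ffunE xS yS axy.
- apply/supp_inP => u uS; rewrite ffunE; case: pickP => // x /andP[xS /eqP axu].
  by case/negP: uS; rewrite -axu imset_f.
- apply/eqP/ffunP => x; rewrite !ffunE; case: ifP => [xS|/negbT/sF->//].
  case: pickP => [y /andP[yS /eqP]|/(_ x)]; first exact: cF.
  by rewrite xS eqxx.
Qed.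

Lemma eq_colour_sum (T X X' : finType) wt (S : {set T}) (a : T -> X)
    (a' : T -> X') Phi Phi' :
  {in S &, forall x y, (a x == a y) = (a' x == a' y)} ->
  (forall F, supp_in S F -> Phi F = Phi' F) ->
  colour_sum wt S a Phi = colour_sum wt S a' Phi'.
Proof.
move=> aa' PP'; rewrite !colour_sum_fibre.
apply: eq_big => [F|F /andP[sF _]].
  congr (_ && _); apply/eq_forallb_in => x xS; apply/eq_forallb_in => y yS.
  by rewrite aa'.
rewrite PP' //; congr (_ * _); apply: eq_bigl => x; rewrite !inE.
case: (boolP (x \in S)) => //= xS; congr (_ == _); apply: eq_pick => y /=.
by case: (boolP (y \in S)) => //= yS; rewrite aa'.
Qed.

Definition restr (T : finType) (S : {set T}) (F : {ffun T -> K}) :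
  {ffun T -> K} := [ffun x => if x \in S then F x else ord0].

(** Without common vertices, an edge function constant on fibres is a pair of such functions, glued
    along [S1] and [S2]. *)
Lemma colour_sumU (T X : finType) wt (S1 S2 : {set T}) (a : T -> X)
    Phi Phi1 Phi2 :
  {in S1 & S2, forall x y, a x != a y} ->
  (forall F, Phi F = Phi1 (restr S1 F) * Phi2 (restr S2 F)) ->
  colour_sum wt (S1 :|: S2) a Phi =
  colour_sum wt S1 a Phi1 * colour_sum wt S2 a Phi2.
Proof.
move=> dis ePhi; rewrite !colour_sum_fibre.
have dis' x : x \in S1 -> x \in S2 -> False.
  by move=> x1 /(dis _ _ x1); rewrite eqxx.
rewrite big_distrlr /= pair_big /=.
pose glue (G : {ffun T -> K} * {ffun T -> K}) : {ffun T -> K} :=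
  [ffun x => if x \in S1 then G.1 x else G.2 x].
rewrite (reindex_onto glue (fun F => (restr S1 F, restr S2 F))) /=; last first.
  move=> F /andP[/supp_inP sF _]; apply/ffunP => x; rewrite !ffunE /=.
  case: (boolP (x \in S1)) => x1 //; case: (boolP (x \in S2)) => x2 //.
  by rewrite sF // inE negb_or x1.
have glue1 F1 F2 x : x \in S1 -> glue (F1, F2) x = F1 x by rewrite ffunE => ->.
have glue2 F1 F2 x : x \in S2 -> glue (F1, F2) x = F2 x.
  by rewrite ffunE; case: ifP => // x1 /(dis' _ x1).
have repsU : fibre_reps (S1 :|: S2) a = fibre_reps S1 a :|: fibre_reps S2 a.
  apply/setP => x; rewrite !inE.
  case x1: (x \in S1); case x2: (x \in S2) => //=.
  - by case: (dis' x).
  - rewrite orbF; congr (_ == _); apply: eq_pick => y /=; rewrite inE.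
    case: (boolP (y \in S1)) => //= _; case: (boolP (y \in S2)) => //= y2.
    by rewrite eq_sym (negPf (dis _ _ x1 y2)).
  - congr (_ == _); apply: eq_pick => y /=; rewrite inE.
    case: (boolP (y \in S1)) => //= y1; case: (boolP (y \in S2)) => //= y2.
    by rewrite (negPf (dis _ _ y1 x2)).
apply: eq_big => [[F1 F2]|[F1 F2] /= /andP[_ /eqP[e1 e2]]]; last first.
  rewrite ePhi e1 e2 mulrACA; congr (_ * _).
  have dr : [disjoint fibre_reps S1 a & fibre_reps S2 a].
    rewrite disjoints_subset; apply/subsetP => x; rewrite !inE => /andP[x1 _].
    by apply/negP => /andP[/(dis' _ x1)].
  rewrite repsU (eq_bigl [predU fibre_reps S1 a & fibre_reps S2 a]) => [|x]; last first.
    by rewrite !inE.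
  rewrite bigU //=; congr (_ * _); apply: eq_bigr => x; rewrite inE => /andP[xS _].
    by rewrite glue1.
  by rewrite glue2.
apply/andP/andP => /=.
  case=> /andP[/supp_inP sF /fibre_constP cF] /eqP[e1 e2]; split; apply/andP; split.
  - by apply/supp_inP => x /negPf x1; rewrite -e1 ffunE x1.
  - apply/fibre_constP => x y x1 y1 axy; rewrite -(glue1 F1 F2 x) // -(glue1 F1 F2 y) //.
    by apply: cF; rewrite ?inE ?x1 ?y1.
  - by apply/supp_inP => x /negPf x1; rewrite -e2 ffunE x1.
  - apply/fibre_constP => x y x1 y1 axy; rewrite -(glue2 F1 F2 x) // -(glue2 F1 F2 y) //.
    by apply: cF; rewrite ?inE ?x1 ?y1 ?orbT.
case=> /andP[/supp_inP s1 /fibre_constP c1] /andP[/supp_inP s2 /fibre_constP c2]; split.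
  apply/andP; split.
    apply/supp_inP => x; rewrite inE negb_or => /andP[x1 x2].
    by rewrite ffunE (negPf x1) s2.
  apply/fibre_constP => x y; rewrite !inE => /orP[] xS /orP[] yS axy.
  - by rewrite !glue1 //; exact: c1.
  - by case/eqP: (dis _ _ xS yS).
  - by case/eqP: (dis _ _ yS xS).
  - by rewrite !glue2 //; exact: c2.
apply/eqP; congr (_, _); apply/ffunP => x; rewrite ffunE.
  by case: ifP => [/glue1->//|/negbT/s1->].
by case: ifP => [/glue2->//|/negbT/s2->].
Qed.

Section Graph.
Variables p q : K -> A.

(* The graph with an edge from the white vertex a x to the black vertex b x for
   each x in S. *)
Definition graph_sum (T X Y : finType) (S : {set T}) (a : T -> X) (b : T -> Y) : A :=
  \sum_(f : {ffun X -> K} | supp_in (a @: S) f)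
  \sum_(h : {ffun Y -> K} | supp_in (b @: S) h)
    [forall x in S, (f (a x) <= h (b x))%N]%:R *
    (\prod_(u in a @: S) p (f u) * \prod_(v in b @: S) q (h v)).

Lemma graph_sumE (T X Y : finType) (S : {set T}) (a : T -> X) (b : T -> Y) :
  graph_sum S a b = colour_sum p S a (fun F => colour_sum q S b (fun H =>
    [forall x in S, (F x <= H x)%N]%:R)).
Proof.
apply: eq_bigr => f _; rewrite mulr_suml; apply: eq_bigr => h _.
rewrite [in RHS]mulrAC -mulrA; congr (_%:R * _).
by congr (nat_of_bool _); apply: eq_forallb => x; apply: implyb_id2l => xS; rewrite !ffunE xS.
Qed.

Lemma eq_graph_sum (T X X' Y Y' : finType) (S : {set T}) (a : T -> X) (a' : T -> X')
    (b : T -> Y) (b' : T -> Y') :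
  {in S &, forall x y, (a x == a y) = (a' x == a' y)} ->
  {in S &, forall x y, (b x == b y) = (b' x == b' y)} ->
  graph_sum S a b = graph_sum S a' b'.
Proof.
move=> aa' bb'; rewrite !graph_sumE; apply: eq_colour_sum => // F _.
exact: eq_colour_sum.
Qed.

Lemma graph_sum_imset (T T' X Y : finType) (i : T' -> T) (S : {set T'})
    (a : T -> X) (b : T -> Y) :
  graph_sum (i @: S) a b = graph_sum S (a \o i) (b \o i).
Proof.
rewrite /graph_sum (imset_comp a i) (imset_comp b i); apply: eq_bigr => f _; apply: eq_bigr => h _.
congr ((nat_of_bool _)%:R * _); apply/forall_inP/forall_inP => fh x.
  by move=> xS; apply: fh; exact: imset_f.
by case/imsetP => y yS ->; exact: fh.
Qed.

Lemma graph_sumU (T X Y : finType) (S1 S2 : {set T}) (a : T -> X) (b : T -> Y) :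
  {in S1 & S2, forall x y, a x != a y} -> {in S1 & S2, forall x y, b x != b y} ->
  graph_sum (S1 :|: S2) a b = graph_sum S1 a b * graph_sum S2 a b.
Proof.
move=> da db; rewrite !graph_sumE; apply: colour_sumU => // F.
apply: colour_sumU => // H; rewrite -natrM mulnb; congr (nat_of_bool _)%:R.
apply/forall_inP/andP => [FH|[/forall_inP F1 /forall_inP F2] x].
  by split; apply/forall_inP => x xS; rewrite !ffunE xS; apply: FH; rewrite inE xS ?orbT.
by rewrite inE => /orP[] xS; [have := F1 x xS|have := F2 x xS]; rewrite !ffunE xS.
Qed.

End Graph.

End Colourings.

(** * Cutting edges of plane trees and of annular maps *)

Lemma sum_subsetU1 (A : nmodType) (T : finType) (e : T) (B : {set T})
    (G : {set T} -> A) : e \notin B ->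
  \sum_(E : {set T} | E \subset e |: B) G E =
  \sum_(E : {set T} | E \subset B) G E + \sum_(E : {set T} | E \subset B) G (e |: E).
Proof.
move=> eB; rewrite (bigID (fun E : {set T} => e \in E)) /= addrC; congr (_ + _).
  apply: eq_bigl => E; apply/andP/idP => [[/subsetP sE eE]|sE].
    apply/subsetP => x xE; have := sE x xE; rewrite !inE.
    by case: eqVneq => //= xe; rewrite -xe xE in eE.
  split; first exact: subset_trans sE (subsetUr _ _).
  by apply: contra eB; exact: (subsetP sE).
rewrite (reindex_onto (fun E : {set T} => e |: E) (fun E => E :\ e)) /=.
  apply: eq_bigl => E; rewrite setU11 andbT; apply/andP/idP => [[sE /eqP eE]|sE].
    apply/subsetP => x; rewrite -eE !inE => /andP[xe]; rewrite (negPf xe) /= => xE.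
    by have := subsetP sE x; rewrite !inE (negPf xe) xE; apply.
  split; first exact: setUS.
  apply/eqP/setU1K; by apply: contra eB; exact: (subsetP sE).
by move=> E /andP[_ eE]; rewrite setD1K.
Qed.

Section Trees.
Variables (A : comNzRingType) (m : nat) (p q : 'I_m.+1 -> A) (T : finType).
Implicit Types (s a b : {perm T}) (S E : {set T}) (k u v w l : seq T) (e g x y z : T).

Definition pair_sum S s a : A := graph_sum p q S (porbit a) (porbit (a^-1 * s)%g).

(** Outside [S] the edge [e] imposes nothing, so it can be made a fixed point of both permutations
    without altering the incidences of the edges in [S]. *)
Lemma pair_sum_del S s a e g : g != e -> a e = e -> s g != e -> e \notin S ->
  pair_sum S s (tperm g e * a)%g =
  pair_sum S (tperm g e * s * tperm e (s g))%g a.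
Proof.
move=> ge ae sg eS; have ne x : x \in S -> x != e by apply: contraTneq => ->.
apply: eq_graph_sum => x y /ne xe /ne ye.
  have ta : (tperm g e * a)%g g = e by rewrite permM tpermL.
  by rewrite -(porbit_del ta ge xe ye) mulgA tperm2 mul1g.
rewrite cutK; set b := (a^-1 * _)%g.
have be : b e = s g.
  have aVe : a^-1%g e = e by rewrite -{1}ae permK.
  by rewrite !permM aVe tpermR.
have -> : (a^-1 * (tperm g e * s * tperm e (s g)) = b * tperm e (b e))%g.
  by rewrite be /b !mulgA.
by rewrite porbit_delV ?be.
Qed.

Lemma pair_sum_mul S1 S2 D1 D2 s1 s2 a1 a2 :
  perm_on D1 a1 -> perm_on D1 s1 -> perm_on D2 a2 -> perm_on D2 s2 ->
  [disjoint D1 & D2] -> S1 \subset D1 -> S2 \subset D2 ->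
  pair_sum (S1 :|: S2) (s1 * s2)%g (a1 * a2)%g =
  pair_sum S1 s1 a1 * pair_sum S2 s2 a2.
Proof.
move=> a1D s1D a2D s2D dis /subsetP sS1 /subsetP sS2.
have b1D := perm_onM (perm_onV a1D) s1D; have b2D := perm_onM (perm_onV a2D) s2D.
have bE : ((a1 * a2)^-1 * (s1 * s2) = (a1^-1 * s1) * (a2^-1 * s2))%g.
  by rewrite invMg !mulgA -(mulgA a2^-1%g) (perm_onC b1D (perm_onV a2D) dis).
have dis' : [disjoint D2 & D1] by rewrite disjoint_sym.
have sep c1 c2 : perm_on D1 c1 -> perm_on D2 c2 ->
    [/\ {in S1, forall x, porbit (c1 * c2)%g x = porbit c1 x},
        {in S2, forall x, porbit (c1 * c2)%g x = porbit c2 x} &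
        {in S1 & S2, forall x y, porbit (c1 * c2)%g x != porbit (c1 * c2)%g y}].
  move=> c1D c2D.
  have e1 : {in S1, forall x, porbit (c1 * c2)%g x = porbit c1 x}.
    by move=> x /sS1 xD; exact: (porbit_mul_on c1D c2D dis xD).
  have e2 : {in S2, forall x, porbit (c1 * c2)%g x = porbit c2 x}.
    by move=> x /sS2 xD; rewrite (perm_onC c1D c2D dis); exact: (porbit_mul_on c2D c1D dis' xD).
  split=> // x y xS yS; rewrite (e1 x xS) (e2 y yS).
  apply: contraTneq (porbit_id c1 x) => ->; apply/negP.
  move/(subsetP (porbit_on c2D (sS2 _ yS))).
  by rewrite (disjointFr dis (sS1 x xS)).
rewrite /pair_sum bE.
have [aE1 aE2 aN] := sep _ _ a1D a2D; have [bE1 bE2 bN] := sep _ _ b1D b2D.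
rewrite graph_sumU //; congr (_ * _); apply: eq_graph_sum => x y xS yS.
- by rewrite !aE1.
- by rewrite !bE1.
- by rewrite !aE2.
- by rewrite !bE2.
Qed.

(** Up to sign, a free cumulant: see [tree_sumE]. *)
Definition tree_sum l : A :=
  \sum_(a | geodesic (pcycle l) a) (-1) ^+ plen a * pair_sum [set x in l] (pcycle l) a.

(* When w and u are the two faces of a map, these are the edges of its loop that are
   oriented one of the two ways. *)
Definition crossing a u w : {set T} := [set e in u | a^-1%g e \in w].

(** The alternating sum of the loop relation, restricted to cuts in [u]: for [u] empty it is the
    weight of the intact map, for [u] a whole face it is the full relation. *)
Definition signed_cuts S s a u w : A :=
  \sum_(E : {set T} | E \subset crossing a u w) (-1) ^+ #|E| * pair_sum (S :\: E) s a.

(* The contour of the trees is the word k ++ u ++ v ++ rcons w z: k has already been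
   examined for a first edge to cut, v and z come from an edge deleted before. *)
Definition cut_sum k u v w z : A :=
  let l := k ++ u ++ v ++ rcons w z in
  \sum_(a | geodesic (pcycle l) a)
     (-1) ^+ plen a * signed_cuts [set y in l] (pcycle l) a u w.

Lemma signed_cuts_nil S s a w : signed_cuts S s a [::] w = pair_sum S s a.
Proof.
rewrite /signed_cuts (big_pred1 set0) ?cards0 ?mul1r ?setD0 // => E.
by rewrite /= -subset0; congr (_ \subset _).
Qed.

Lemma cut_sum_nil k v w z : cut_sum k [::] v w z = tree_sum (k ++ v ++ rcons w z).
Proof. by apply: eq_bigr => a _; rewrite signed_cuts_nil. Qed.

(** The sets E are separated by whether they contain [e]. If [e] is a crossing edge, its predecessor
    sits at exactly one position of [w]; summing over that position lets the sum over [a] be cut at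
    a fixed pair of points. *)
Lemma signed_cuts_cons S s a e u w : e \notin u -> uniq w ->
  signed_cuts S s a (e :: u) w = signed_cuts S s a u w -
  \sum_(i < size w | a (nth e w i) == e) signed_cuts (S :\ e) s a u w.
Proof.
move=> eu uw.
have eC : e \notin crossing a u w by rewrite inE (negPf eu).
have [ew|ew] := boolP (a^-1%g e \in w); last first.
  rewrite big_pred0 ?subr0; last first.
    by move=> i; apply/negbTE; apply: contra ew => /eqP <-; rewrite permK mem_nth.
  rewrite /signed_cuts; have -> // : crossing a (e :: u) w = crossing a u w.
  apply/setP => x; rewrite !inE andb_orl.
  by case: eqVneq => //= ->; rewrite (negPf ew) andbF.
have CE : crossing a (e :: u) w = e |: crossing a u w.
  by apply/setP => x; rewrite !inE andb_orl; case: eqVneq => //= ->; rewrite ew.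
rewrite /signed_cuts CE sum_subsetU1 //; congr (_ + _).
have lt : (index (a^-1%g e) w < size w)%N by rewrite index_mem.
rewrite (big_pred1 (Ordinal lt)) => [|i]; last first.
  rewrite /= -val_eqE /=; apply/eqP/eqP => [h|->]; last by rewrite nth_index // permKV.
  by rewrite -h permK index_uniq.
rewrite -sumrN; apply: eq_bigr => E sE.
have eE : e \notin E by apply: contra eC; exact: (subsetP sE).
rewrite cardsU1 eE exprS mulN1r -mulNr; congr (_ * pair_sum _ _ _).
by rewrite setDDl.
Qed.

(** Rotated to start at [g], the contour has the shape of [pcycle_split]; a letter of [w1] has to be
    there to follow [g] before [e]. *)
Lemma pcycle_cut k e u g w1 : w1 != [::] -> uniq (k ++ e :: u ++ g :: w1) ->
  let s := pcycle (k ++ e :: u ++ g :: w1) in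
  s g \in w1 /\
  (tperm g e * s * tperm e (s g) = pcycle (k ++ w1) * pcycle (rcons u g))%g.
Proof.
case: w1 => // x w1 _ ul s.
have ul' : uniq (g :: x :: (w1 ++ k) ++ e :: u).
  move: ul; rewrite -(rot_uniq (size (k ++ e :: u))) -cat_cons catA rot_size_cat.
  by rewrite !cat_cons -!catA.
have sE : s = pcycle (g :: x :: (w1 ++ k) ++ e :: u).
  move: ul; rewrite /s -cat_cons catA => /pcycle_catC ->.
  by rewrite !cat_cons -!catA.
have sg : s g = x by rewrite sE pcycle_next.
rewrite sg mem_head sE pcycle_split //; split=> //; congr (_ * _)%g.
  rewrite -cat_cons pcycle_catC //.
  by move: ul'; rewrite cons_uniq -!cat_cons cat_uniq => /and3P[_ -> _].
rewrite pcycle_rcons //; apply: subseq_uniq ul'; rewrite -cat_cons.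
apply: (@cat_subseq _ [:: g] u [:: g]) => //.
exact: subseq_trans (subseq_cons u e) (suffix_subseq _ _).
Qed.

Lemma pair_sum_disjoint_cut s s1 s2 D1 D2 S2 a1 a2 e g :
  perm_on D1 a1 -> perm_on D1 s1 -> perm_on D2 a2 -> perm_on D2 s2 ->
  [disjoint D1 & D2] -> S2 \subset D2 -> g != e -> e \notin D1 -> e \notin D2 ->
  s g != e -> (tperm g e * s * tperm e (s g) = s1 * s2)%g ->
  pair_sum (D1 :|: S2) s (tperm g e * (a1 * a2))%g =
  pair_sum D1 s1 a1 * pair_sum S2 s2 a2.
Proof.
move=> a1D s1D a2D s2D dis sS2 ge e1 e2 sg sE.
rewrite pair_sum_del //; first by rewrite sE; exact: pair_sum_mul a1D s1D a2D s2D _ _ _.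
  by rewrite permM (out_perm a1D) // (out_perm a2D).
by rewrite inE negb_or e1; apply: contra e2; exact: (subsetP sS2).
Qed.

(** If [e] is kept, it joins the examined part [k]. If it is cut, with predecessor [g] in [w], the
    tree falls into two: the one containing [k] has nothing left to cut and becomes a factor, the
    other is a smaller instance closed by [g]. The sign of E and the change of [plen a] cancel. *)
Lemma cut_sum_cons k e u v w z : uniq (k ++ (e :: u) ++ v ++ rcons w z) ->
  cut_sum k (e :: u) v w z = cut_sum (rcons k e) u v w z +
    \sum_(i < size w) tree_sum (k ++ rcons (drop i.+1 w) z) *
                       cut_sum [::] u v (take i w) (nth e w i).
Proof.
move=> ul; rewrite /cut_sum cat_rcons; set l := k ++ e :: u ++ _ in ul *.
have uw : uniq w.
  move: ul; rewrite /l -cat_cons !catA cat_uniq => /and3P[_ _].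
  by rewrite rcons_uniq => /andP[].
have eu : e \notin u.
  move: ul; rewrite /l cat_uniq => /and3P[_ _ /= /andP[+ _]].
  by rewrite mem_cat => /norP[].
under eq_bigr do rewrite signed_cuts_cons // mulrBr.
rewrite sumrB; congr (_ + _).
under eq_bigr do rewrite big_mkcond mulr_sumr.
rewrite exchange_big -sumrN; apply: eq_bigr => i _.
set g := nth e w i; set w1 := rcons (drop i.+1 w) z.
have wE : rcons w z = take i w ++ g :: w1.
  by rewrite /w1 -rcons_cons -drop_nth // -rcons_cat cat_take_drop.
have lE : l = k ++ e :: (u ++ v ++ take i w) ++ g :: w1.
  by rewrite /l wE !catA.
have w10 : w1 != [::] by rewrite /w1; case: (drop _ _).
have ul2 := ul; rewrite lE in ul2.
have [sg sE] := pcycle_cut w10 ul2.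
rewrite -lE in sg sE; rewrite -rcons_cat -rcons_cat.
set l1 := k ++ w1 in sE *; set l2 := rcons _ _ in sE *.
set s := pcycle l in sg sE *.
have lP : perm_eq l (e :: l1 ++ l2).
  by apply/seq.permP => P; rewrite lE /l1 /l2 -cats1 /= !count_cat /= !count_cat /=; lia.
have := ul; rewrite (perm_uniq lP) cons_uniq mem_cat cat_uniq negb_or.
case/and3P => /andP[e1 e2] ul1 /andP[dis ul_2].
set D1 := [set y in l1]; set D2 := [set y in l2].
have dD : [disjoint D1 & D2].
  rewrite disjoint_sym disjoints_subset; apply/subsetP => y; rewrite !inE => y2.
  by apply: contra dis => y1; apply/hasP; exists y.
have ge : g != e.
  by apply: contraNneq e2 => <-; rewrite mem_rcons mem_head.
have sgl1 : s g \in l1 by rewrite mem_cat sg orbT.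
have sge : s g != e by apply: contraNneq e1 => <-.
have e1D : e \notin D1 by rewrite inE.
have e2D : e \notin D2 by rewrite inE.
have on1 : perm_on D1 (pcycle l1) := pcycle_on l1.
have on2 : perm_on D2 (pcycle l2) := pcycle_on l2.
have plE : plen s = (plen (pcycle l1 * pcycle l2)%g).+2.
  rewrite (plen_disjoint on1 on2 dD) !plen_pcycle // (perm_size lP) /= size_cat.
  have : (0 < size l1)%N by rewrite size_cat addn_gt0 size_rcons orbT.
  have : (0 < size l2)%N by rewrite size_rcons.
  by move: (size l1) (size l2) => [|n1] [|n2] //= _ _; rewrite addSn addnS.
have s'e : (pcycle l1 * pcycle l2)%g e = e by rewrite permM !pcycle_out.
transitivity (- \sum_(a : {perm T} | (a g == e) &&
   (plen a + plen (a^-1 * s)%g == (plen (pcycle l1 * pcycle l2)%g).+2)%N)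
     (-1) ^+ plen a * signed_cuts ([set y in l] :\ e) s a u w).
  congr (- _); rewrite -plE [RHS]big_mkcond [LHS]big_mkcond; apply: eq_bigr => a _ /=.
  by rewrite /geodesic; case: (a g == e); rewrite ?mulr0 ?if_same.
rewrite (sum_cut _ ge sge (esym sE) s'e) (sum_geodesic_mul _ on1 on2 dD).
rewrite -sumrN mulr_suml; apply: eq_bigr => a1 g1.
rewrite -sumrN mulr_sumr; apply: eq_bigr => a2 g2 /=.
have a1D := geodesic_on g1 on1; have a2D := geodesic_on g2 on2.
rewrite plen_insert //; last by rewrite permM (out_perm a1D) // (out_perm a2D).
rewrite (plen_disjoint a1D a2D) // exprS mulN1r mulNr opprK exprD.
rewrite -!mulrA; congr (_ * _); rewrite mulrCA; congr (_ * _).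
have -> : [set y in l] :\ e = D1 :|: D2.
  apply/setP => y; rewrite !inE (perm_mem lP) inE mem_cat.
  by case: eqVneq => //= ->; rewrite (negPf e1) (negPf e2).
rewrite mulr_sumr /signed_cuts.
have ul2D x : x \in u -> x \in l2.
  by move=> xu; rewrite mem_rcons inE !mem_cat xu orbT.
have ew : e \notin w.
  move: ul; rewrite /l cat_uniq /= mem_cat => /and3P[_ _ /andP[/norP[_ +] _]].
  by rewrite mem_cat mem_rcons inE => /norP[_ /norP[]].
have gw : g \notin take i w.
  by move: ul_2; rewrite rcons_uniq !mem_cat => /andP[/norP[_ /norP[]]].
(* The predecessor of an edge of [u] lies in the same tree, hence not in the part of [w] after [g].
   If it is [g] for [a2], it was [e] before the deletion: [e] is not in [w] and [g] is not in
   [take i w], so neither side counts this edge. *)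
have crE : crossing (tperm g e * (a1 * a2))%g u w = crossing a2 u (take i w).
  apply/setP => x; rewrite !inE; apply: andb_id2l => /ul2D xl2.
  rewrite !invMg tpermV !permM; set y := a2^-1%g x.
  have yl2 : y \in D2 by rewrite /y (perm_closed _ (perm_onV a2D)) inE.
  rewrite (out_perm (perm_onV a1D)) ?(disjointFl dD) //.
  have [->|yg] := eqVneq y g; first by rewrite tpermL (negPf ew) (negPf gw).
  have ye : y != e by apply: contraNneq e2D => <-.
  rewrite tpermD 1?eq_sym //; rewrite -{1}(cat_take_drop i w) mem_cat.
  rewrite (drop_nth e) // -/g inE (negPf yg) /=; case yd: (y \in drop _ _); last first.
    by rewrite orbF.
  have: y \in D1 by rewrite inE mem_cat mem_rcons inE yd !orbT.
  by rewrite (disjointFl dD).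
rewrite crE; apply: eq_bigr => E sEc.
have sED : E \subset D2.
  apply: subset_trans sEc _; apply/subsetP => x; rewrite !inE => /andP[/ul2D].
  by [].
have -> : (D1 :|: D2) :\: E = D1 :|: (D2 :\: E).
  rewrite setDUl; congr (_ :|: _); apply/setDidPl.
  by rewrite disjoint_sym (disjointWl sED) // disjoint_sym.
rewrite (pair_sum_disjoint_cut a1D on1 a2D on2 dD (subsetDl _ _) ge e1D e2D sge sE).
by rewrite mulrCA.
Qed.

End Trees.

(** * Annular maps *)

Section Annulus.
Variables (A : comNzRingType) (m : nat) (p q : 'I_m.+1 -> A) (T : finType).
Implicit Types (s a b : {perm T}) (S E : {set T}) (k u v w l : seq T) (e g x y z : T).

(** For a connected map with two faces, an excess of two in length is planarity. Connectedness is
    not imposed; [sum_transitive] disposes of the other pairs. *)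
Definition annular_sum k u w : A :=
  let s := (pcycle (k ++ u) * pcycle w)%g in
  \sum_(a : {perm T} | (plen a + plen (a^-1 * s)%g == (plen s).+2)%N)
     (-1) ^+ plen a * signed_cuts p q [set y in (k ++ u) ++ w] s a u w.

(** The first deletion joins the two faces and uses up the excess two ([sum_cut]); what remains is a
    plane tree with a single contour, so [cut_sum] takes over. *)
Lemma annular_sum_cons k e u w : uniq ((k ++ e :: u) ++ w) ->
  annular_sum k (e :: u) w = annular_sum (rcons k e) u w +
    \sum_(i < size w)
      cut_sum p q [::] u k (drop i.+1 w ++ take i w) (nth e w i).
Proof.
move=> ul; rewrite /annular_sum cat_rcons; set l := (_ ++ w) in ul *.
set s := (_ * _)%g.
have [uk uw] : uniq (k ++ e :: u) /\ uniq w.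
  by move: ul; rewrite /l cat_uniq => /and3P[-> _ ->].
have eu : e \notin u.
  by move: uk; rewrite cat_uniq => /and3P[_ _ /= /andP[]].
have ew : e \notin w.
  move: ul; rewrite /l cat_uniq => /and3P[_ /hasPn h _].
  by apply/negP => /h; rewrite mem_cat mem_head orbT.
under eq_bigr do rewrite signed_cuts_cons // mulrBr.
rewrite sumrB; congr (_ + _).
under eq_bigr do rewrite big_mkcond mulr_sumr.
rewrite exchange_big -sumrN; apply: eq_bigr => i _.
set g := nth e w i; set w0 := drop i.+1 w ++ take i w.
have wP : w = take i w ++ g :: drop i.+1 w.
  by rewrite -drop_nth // cat_take_drop.
have lP : perm_eq l (e :: (u ++ k ++ rcons w0 g)).
  apply/seq.permP => P; rewrite /l {1}wP /w0 -cats1 !count_cat /= !count_cat /=.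
  by move: (count P k) (count P u); lia.
have := ul; rewrite (perm_uniq lP) => ul2.
have ge : g != e by apply: contraNneq ew => <-; apply: mem_nth.
have gu : uniq (g :: w0).
  move: ul2; rewrite cons_uniq catA cat_uniq => /andP[_ /and3P[_ _]].
  by rewrite rcons_uniq.
have pw : pcycle w = pcycle (g :: w0).
  by rewrite {1}wP pcycle_catC -?wP.
have sg : s g = pcycle (g :: w0) g.
  have gk : g \notin k ++ e :: u.
    move: ul; rewrite /l cat_uniq => /and3P[_ /hasPn h _].
    by apply/negP => gk; have := h g (mem_nth _ (ltn_ord i)); rewrite gk.
  by rewrite /s permM (pcycle_out gk) pw.
have sgw : s g \in w.
  have gw : g \in [set y in w] by rewrite inE mem_nth.
  by have := perm_closed g (pcycle_on w); rewrite gw pw -sg inE.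
have sge : s g != e by apply: contraNneq ew => <-.
have sE : (tperm g e * s * tperm e (s g) = pcycle (u ++ k ++ rcons w0 g))%g.
  rewrite /s sg pw pcycle_catC // cat_cons pcycle_merge; last first.
    suff : perm_eq l (e :: (u ++ k) ++ g :: w0) by move/perm_uniq => <-.
    apply: perm_trans lP _.
    by rewrite perm_cons catA perm_cat2l perm_rcons.
  rewrite -pcycle_rcons; last first.
    suff : perm_eq (u ++ k ++ rcons w0 g) (g :: (u ++ k) ++ w0).
      by move/perm_uniq => <-; move: ul2 => /andP[].
    by rewrite catA -rcons_cat perm_rcons.
  by rewrite -catA !rcons_cat.
set l2 := u ++ _ in sE lP ul2 *.
move: ul2; rewrite cons_uniq => /andP[el2 ul2].
have on2 := pcycle_on l2; set D := [set y in l2] in on2.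
have eD : e \notin D by rewrite inE.
have dLw : [disjoint [set y in k ++ e :: u] & [set y in w]].
  rewrite disjoint_sym disjoints_subset; apply/subsetP => y; rewrite !inE => yw.
  by move: ul; rewrite /l cat_uniq => /and3P[_ /hasPn/(_ _ yw)].
(* One point and one cycle disappear together, so the length of the face permutation is
   unchanged. *)
have plE : plen s = plen (pcycle l2).
  rewrite (plen_disjoint (pcycle_on _) (pcycle_on _) dLw) !plen_pcycle //.
  have -> : size l2 = (size l).-1 by rewrite (perm_size lP).
  rewrite /l !size_cat /=.
  have : (0 < size w)%N by exact: leq_ltn_trans (ltn_ord i).
  by case: (size w) => // n _; rewrite !addnS.
have s'e : pcycle l2 e = e by rewrite pcycle_out.
transitivity (- \sum_(a : {perm T} | (a g == e) &&
   (plen a + plen (a^-1 * s)%g == (plen (pcycle l2)).+2)%N)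
     (-1) ^+ plen a * signed_cuts p q ([set y in l] :\ e) s a u w).
  congr (- _); rewrite -plE [RHS]big_mkcond [LHS]big_mkcond; apply: eq_bigr => a _ /=.
  by case: (a g == e); rewrite ?mulr0 ?if_same.
rewrite (sum_cut _ ge sge (esym sE) s'e) -sumrN; apply: eq_bigr => a ga.
have aD := geodesic_on ga on2.
have ae : a e = e by rewrite (out_perm aD).
rewrite plen_insert // exprS mulN1r mulNr opprK; congr (_ * _).
have -> : [set y in l] :\ e = D.
  apply/setP => y; rewrite !inE (perm_mem lP) inE.
  by case: eqVneq => //= ->; rewrite (negPf el2).
have uD x : x \in u -> x \in D by move=> xu; rewrite inE mem_cat xu.
have gw : g \notin w0 by move: gu; rewrite cons_uniq => /andP[].
have crE : crossing (tperm g e * a)%g u w = crossing a u w0.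
  apply/setP => x; rewrite !inE; apply: andb_id2l => /uD xD.
  rewrite !invMg tpermV !permM; set y := a^-1%g x.
  have yD : y \in D by rewrite /y (perm_closed _ (perm_onV aD)).
  have [->|yg] := eqVneq y g; first by rewrite tpermL (negPf ew) (negPf gw).
  have ye : y != e by apply: contraNneq eD => <-.
  by rewrite tpermD 1?eq_sym // {1}wP !mem_cat inE (negPf yg) orbC.
rewrite /signed_cuts crE; apply: eq_bigr => E _; congr (_ * _).
by rewrite pair_sum_del ?sE // inE negb_and eD orbT.
Qed.

Lemma annular_sum_cat k u w : uniq ((k ++ u) ++ w) ->
  annular_sum k u w = annular_sum (k ++ u) [::] w +
    \sum_(j < size u) \sum_(i < size w)
      if drop j u is e :: u' then
        cut_sum p q [::] u' (k ++ take j u) (drop i.+1 w ++ take i w) (nth e w i)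
      else 0.
Proof.
elim: u k => [|e u IH] k ul; first by rewrite cats0 big_ord0 addr0.
rewrite annular_sum_cons // IH ?cat_rcons // big_ord_recl /= cats0 -addrA.
congr (_ + _); rewrite addrC; congr (_ + _).
by apply: eq_bigr => j _; apply: eq_bigr => i _; rewrite cat_rcons.
Qed.

End Annulus.

(** * The loop relation *)

Lemma porbit_permE (T : finType) (s : {perm T}) x : porbit s (s x) = porbit s x.
Proof. by have := porbit_perm s 1 x; rewrite expg1. Qed.

(** If [P] fails somewhere outside [B], every term is 0. Otherwise toggling in E an [e] of [B] that
    satisfies [P] reverses the sign and keeps the constraint. *)
Lemma sum_subset_sign (A : pzRingType) (T : finType) (B : {set T}) (P : pred T) :
  ((forall x, x \notin B -> P x) -> exists2 e, e \in B & P e) ->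
  \sum_(E : {set T} | E \subset B)
     (-1) ^+ #|E| * [forall x in ~: E, P x]%:R = 0 :> A.
Proof.
move=> exP; have [/forall_inP PB|] := boolP [forall x in ~: B, P x]; last first.
  move=> /forall_inPn[x xB Px]; apply: big1 => E /subsetP sE.
  suff -> : [forall x in ~: E, P x] = false by rewrite mulr0.
  apply/negbTE/forall_inPn; exists x => //; move: xB; rewrite !inE.
  by apply: contra => /sE.
have [|e eB Pe] := exP; first by move=> x xB; apply: PB; rewrite inE.
rewrite -(setD1K eB) sum_subsetU1 ?setD11 // -big_split; apply: big1 => E /= sE.
have eE : e \notin E by apply/negP => /(subsetP sE); rewrite setD11.
rewrite cardsU1 eE exprS mulN1r.
suff -> : [forall x in ~: (e |: E), P x] = [forall x in ~: E, P x].
  by rewrite mulNr subrr.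
apply/forall_inP/forall_inP => h x; rewrite !inE => xE.
  by have [->//|xe] := eqVneq x e; apply: h; rewrite !inE (negPf xe).
by apply: h; rewrite inE; move: xE; rewrite negb_or => /andP[].
Qed.

Section Loop.
Variables (A : comNzRingType) (m : nat) (p q : 'I_m.+1 -> A) (T : finType).
Variables (s a : {perm T}) (C : {set T}).
Hypothesis sC : forall x, (s x \in C) = (x \in C).
Let b := (a^-1 * s)%g.
Let X := [set e in C | a^-1%g e \notin C].

Let bC x : (b x \in C) = (a^-1%g x \in C).
Proof. by rewrite permM sC. Qed.

(* A circulation argument: around each vertex, X and the set of edges crossing in
   the opposite direction are equinumerous. *)
Lemma exists_monotone_crossing (f h : {set T} -> nat) : X != set0 ->
  (forall x, x \notin X -> (f (porbit a x) <= h (porbit b x))%N) ->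
  exists2 e, e \in X & (f (porbit a e) <= h (porbit b e))%N.
Proof.
case/set0Pn => e eX mon; apply/exists_inP; apply: contraT => /exists_inPn viol.
(* [c] sums to 0 over each orbit of [a] and of [b], so the [t x] add up to 0. If every edge of [X]
   were violated, all [t x] would be nonnegative and those on [X] positive. *)
pose c x : int := (x \in C)%:R - (a^-1%g x \in C)%:R.
pose t x : int := c x * ((f (porbit a x))%:R - (h (porbit b x))%:R).
have t_ge0 x : 0 <= t x.
  rewrite /t /c; have := viol x; have := mon x; rewrite /X inE.
  case: (x \in C); case: (a^-1%g x \in C) => /= mx vx.
  - by rewrite subrr mul0r.
  - by rewrite subr0 mul1r subr_ge0 ler_nat; move: (vx isT); lia.
  - by rewrite sub0r mulN1r opprB subr_ge0 ler_nat mx.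
  - by rewrite subrr mul0r.
have : \sum_x t x = 0.
  rewrite /t; under eq_bigr do rewrite mulrBr.
  rewrite sumrB; apply/eqP; rewrite subr_eq0; apply/eqP; transitivity (0 : int).
    rewrite /c; under eq_bigr do rewrite mulrBl.
    rewrite sumrB; apply/eqP; rewrite subr_eq0; apply/eqP.
    rewrite [RHS](reindex_inj (@perm_inj _ a)) /=; apply: eq_bigr => x _.
    by rewrite permK porbit_permE.
  apply/esym; rewrite /c; under eq_bigr do rewrite mulrBl.
  rewrite sumrB; apply/eqP; rewrite subr_eq0; apply/eqP.
  rewrite (reindex_inj (@perm_inj _ b)) /=; apply: eq_bigr => x _.
  by rewrite bC porbit_permE.
move/psumr_eq0P => /(_ (fun x _ => t_ge0 x)) /(_ e isT) te0.
have := viol e eX; have := eX; rewrite inE => /andP[eC aeC].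
move: te0; rewrite /t /c eC (negPf aeC) subr0 mul1r => /eqP.
by rewrite subr_eq0 eqr_nat => /eqP ->; rewrite leqnn.
Qed.

Lemma loop_relation : X != set0 ->
  \sum_(E : {set T} | E \subset X) (-1) ^+ #|E| * pair_sum p q (~: E) s a = 0.
Proof.
move=> X0.
(* No vertex disappears with E: for [x] in [X], the edge before [x] at its white vertex and the one
   after it at its black vertex lie outside [C], hence outside [X]. All the terms then sum over the
   same colourings. *)
have imE (E : {set T}) : E \subset X -> porbit a @: (~: E) = porbit a @: setT.
  move=> /subsetP sE; apply/eqP; rewrite eqEsubset imsetS ?subsetT //=.
  apply/subsetP => _ /imsetP[x _ ->].
  have [xE|xE] := boolP (x \in E); last by rewrite imset_f // inE.
  rewrite -[x](permKV a) porbit_permE imset_f // inE; apply/negP => /sE.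
  by rewrite inE => /andP[aC _]; have := sE _ xE; rewrite inE aC andbF.
have imEb (E : {set T}) : E \subset X -> porbit b @: (~: E) = porbit b @: setT.
  move=> /subsetP sE; apply/eqP; rewrite eqEsubset imsetS ?subsetT //=.
  apply/subsetP => _ /imsetP[x _ ->].
  have [xE|xE] := boolP (x \in E); last by rewrite imset_f // inE.
  rewrite -porbit_permE imset_f // inE; apply/negP => /sE.
  by rewrite inE bC => /andP[aC _]; have := sE _ xE; rewrite inE aC andbF.
transitivity (\sum_(f : {ffun {set T} -> 'I_m.+1} | supp_in (porbit a @: setT) f)
   \sum_(h : {ffun {set T} -> 'I_m.+1} | supp_in (porbit b @: setT) h)
   (\sum_(E : {set T} | E \subset X) (-1) ^+ #|E| *
      [forall x in ~: E, (f (porbit a x) <= h (porbit b x))%N]%:R) *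
   (\prod_(u in porbit a @: setT) p (f u) * \prod_(v in porbit b @: setT) q (h v))).
  transitivity (\sum_(E : {set T} | E \subset X)
    \sum_(f : {ffun {set T} -> 'I_m.+1} | supp_in (porbit a @: setT) f)
    \sum_(h : {ffun {set T} -> 'I_m.+1} | supp_in (porbit b @: setT) h)
    (-1) ^+ #|E| * [forall x in ~: E, (f (porbit a x) <= h (porbit b x))%N]%:R *
    (\prod_(u in porbit a @: setT) p (f u) * \prod_(v in porbit b @: setT) q (h v))).
    apply: eq_bigr => E sE; rewrite /pair_sum /graph_sum imE // imEb // mulr_sumr.
    by apply: eq_bigr => f _; rewrite mulr_sumr; apply: eq_bigr => h _; rewrite !mulrA.
  rewrite exchange_big; apply: eq_bigr => f _; rewrite exchange_big.
  by apply: eq_bigr => h _; rewrite mulr_suml.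
apply: big1 => f _; apply: big1 => h _; rewrite sum_subset_sign ?mul0r //.
exact: (@exists_monotone_crossing (fun u => f u) (fun v => h v)).
Qed.

End Loop.

(** * Permutations with two cycles *)

Lemma porbit_pcycle (T : finType) (l : seq T) : uniq l ->
  {in l &, forall x y, y \in porbit (pcycle l) x}.
Proof.
move=> ul x y xl yl.
have h i : (i < size l)%N -> nth x l i \in porbit (pcycle l) (nth x l 0).
  elim: i => [|i IH] il; first exact: porbit_id.
  rewrite -(modn_small il) -pcycle_nth ?(ltnW il) // porbit_sym.
  by rewrite -eq_porbit_mem porbit_permE eq_porbit_mem porbit_sym IH // ltnW.
have := h (index x l); have := h (index y l); rewrite !index_mem !nth_index //.
move=> /(_ yl) yx /(_ xl); rewrite -!eq_porbit_mem => /eqP ->.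
by rewrite eq_porbit_mem.
Qed.

Section Two.
Variables (T : finType) (ls lr : seq T).
Hypotheses (ul : uniq (ls ++ lr)) (lT : forall x, x \in ls ++ lr).
Hypotheses (ls0 : ls != [::]) (lr0 : lr != [::]).
Let s := (pcycle ls * pcycle lr)%g.

Lemma mem_compl x : (x \in lr) = (x \notin ls).
Proof.
have := lT x; rewrite mem_cat; have [xs|//] := boolP (x \in ls).
move=> _; move: ul; rewrite cat_uniq => /and3P[_ /hasPn h _].
by apply/negbTE/negP => /h; rewrite xs.
Qed.

Let dis : [disjoint [set x in ls] & [set x in lr]].
Proof.
by rewrite disjoints_subset; apply/subsetP => x; rewrite !inE mem_compl negbK.
Qed.

Lemma two_cycles_closed x : (s x \in ls) = (x \in ls).
Proof.
have [xs|xs] := boolP (x \in ls).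
  have psx : pcycle ls x \in ls.
    by have := perm_closed x (pcycle_on ls); rewrite !inE xs.
  by rewrite permM (pcycle_out (l := lr)) // mem_compl negbK.
rewrite permM (pcycle_out xs); apply/negbTE.
by have := perm_closed x (pcycle_on lr); rewrite !inE !mem_compl xs.
Qed.

Lemma two_cycles_porbit x y : (y \in porbit s x) = ((y \in ls) == (x \in ls)).
Proof.
have usr : uniq ls /\ uniq lr by move: ul; rewrite cat_uniq => /and3P[].
apply/idP/eqP => [/porbitP[i ->]|yx].
  by elim: i => [|i IH]; rewrite ?perm1 // expgSr permM two_cycles_closed.
have [xs|xs] := boolP (x \in ls).
  rewrite (porbit_mul_on (pcycle_on ls) (pcycle_on lr) dis) ?inE //.
  by apply: porbit_pcycle => //; [case: usr | rewrite yx].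
rewrite /s (perm_onC (pcycle_on ls) (pcycle_on lr) dis).
rewrite (porbit_mul_on (pcycle_on lr) (pcycle_on ls)) ?inE ?mem_compl //.
  by rewrite porbit_pcycle ?mem_compl ?yx ?xs //; case: usr.
by rewrite disjoint_sym.
Qed.

(** Without crossing edges [a] stabilises [ls], as [s] does, and so does the whole group. One
    crossing edge connects the two orbits of [s]. *)
Lemma transitive_crossing (a b : {perm T}) : (a * b)%g = s ->
  [transitive <<[set a; b]>>, on [set: T] | 'P]%g = (crossing a ls lr != set0).
Proof.
move=> ab; set G := <<_>>%g.
have aG : a \in G by rewrite mem_gen // !inE eqxx.
have bG : b \in G by rewrite mem_gen // !inE eqxx orbT.
have sG : s \in G by rewrite -ab groupM.
apply/idP/set0Pn => [trG|[e]].
  apply/existsP; apply: contraT; rewrite negb_exists => /forallP cr0.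
  have aC x : x \in ls -> a^-1%g x \in ls.
    by move=> xs; have := cr0 x; rewrite !inE xs mem_compl negbK.
  have aN : a^-1%g \in 'N([set x in ls] | 'P).
    by rewrite !inE; apply/subsetP => x; rewrite !inE /= /aperm; exact: aC.
  have sN : s \in 'N([set x in ls] | 'P).
    rewrite !inE; apply/subsetP => x; rewrite !inE /= /aperm => xs.
    by rewrite two_cycles_closed.
  have GN : G \subset 'N([set x in ls] | 'P).
    rewrite gen_subG; apply/subsetP => c; rewrite in_set2 => /orP[]/eqP->.
      exact: groupVl.
    have -> : b = (a^-1 * s)%g by rewrite -ab mulKg.
    by rewrite groupM.
  have /hasP[x xs _] : has predT ls by move: ls0; case: (ls).
  have /hasP[y yr _] : has predT lr by move: lr0; case: (lr).
  have := atransP trG x (in_setT x) => oT.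
  have : y \in orbit 'P G x by rewrite oT inE.
  case/imsetP => c cG yE; move: yr; rewrite mem_compl yE => /negP[].
  have := subsetP GN c cG; rewrite !inE => /subsetP/(_ x).
  by rewrite !inE; apply.
rewrite inE => /andP[es]; rewrite mem_compl => aes.
apply/imsetP; exists e => //; apply/eqP; rewrite eqEsubset subsetT andbT.
apply/subsetP => y _; have sorb z : z \in porbit s e -> z \in orbit 'P G e.
  by move=> /porbitP[i ->]; apply/imsetP; exists (s ^+ i)%g; rewrite ?groupX.
have [ys|ys] := boolP (y \in ls); first by apply: sorb; rewrite two_cycles_porbit ys es.
have /porbitP[i ->] : y \in porbit s (a^-1%g e).
  by rewrite two_cycles_porbit (negPf ys) (negPf aes).
apply/imsetP; exists (a^-1 * s ^+ i)%g; first by rewrite groupM ?groupV ?groupX.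
by rewrite /= /aperm permM.
Qed.

End Two.

(** * Transport along an injection, and trees as free cumulants *)

Section Extend.
Variables (T' T : finType) (i : T' -> T).
Hypothesis inj_i : injective i.
Implicit Types (c a : {perm T'}) (b : {perm T}) (y z : T').

Definition ext_fun c (x : T) : T := if [pick y | i y == x] is Some y then i (c y) else x.

Lemma ext_funE c y : ext_fun c (i y) = i (c y).
Proof.
rewrite /ext_fun; case: pickP => [z /eqP/inj_i->//|/(_ y)].
by rewrite eqxx.
Qed.

Lemma ext_fun_out c x : x \notin codom i -> ext_fun c x = x.
Proof.
rewrite /ext_fun; case: pickP => // z /eqP <-.
by rewrite codom_f.
Qed.

Lemma ext_fun_inj c : injective (ext_fun c).
Proof.
move=> x1 x2; have [/codomP[y1 ->]|x1i] := boolP (x1 \in codom i);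
  have [/codomP[y2 ->]|x2i] := boolP (x2 \in codom i);
  rewrite ?ext_funE ?(ext_fun_out _ x1i) ?(ext_fun_out _ x2i) //.
- by move/inj_i/perm_inj ->.
- by move=> e; rewrite -e codom_f in x2i.
- by move=> e; rewrite e codom_f in x1i.
Qed.

Definition ext_perm c : {perm T} := perm (@ext_fun_inj c).

Lemma ext_permE c y : ext_perm c (i y) = i (c y).
Proof. by rewrite permE ext_funE. Qed.

Lemma ext_perm_out c x : x \notin codom i -> ext_perm c x = x.
Proof. by move=> xi; rewrite permE ext_fun_out. Qed.

Lemma ext_perm_eq c b : (forall y, b (i y) = i (c y)) ->
  (forall x, x \notin codom i -> b x = x) -> b = ext_perm c.
Proof.
move=> bi bo; apply/permP => x.
have [/codomP[y ->]|xi] := boolP (x \in codom i); first by rewrite bi ext_permE.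
by rewrite bo // ext_perm_out.
Qed.

Lemma ext_permM a c : ext_perm (a * c)%g = (ext_perm a * ext_perm c)%g.
Proof.
by apply/esym/ext_perm_eq => [y|x xi]; rewrite !permM ?ext_permE // !ext_perm_out.
Qed.

Lemma ext_perm1 : ext_perm 1%g = 1%g.
Proof. by apply/esym/ext_perm_eq => [y|x _]; rewrite !perm1. Qed.

Lemma ext_permV c : ext_perm c^-1%g = (ext_perm c)^-1%g.
Proof. by apply: (mulgI (ext_perm c)); rewrite mulgV -ext_permM mulgV ext_perm1. Qed.

Lemma ext_permX c n : ext_perm (c ^+ n)%g = (ext_perm c ^+ n)%g.
Proof. by elim: n => [|n IH]; rewrite ?ext_perm1 // !expgS ext_permM IH. Qed.

Lemma ext_tperm y z : ext_perm (tperm y z) = tperm (i y) (i z).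
Proof.
apply/esym/ext_perm_eq => [w|x xi]; first by rewrite inj_tperm.
by rewrite tpermD //; apply: contraNneq xi => <-; rewrite codom_f.
Qed.

Lemma ext_perm_inj : injective ext_perm.
Proof.
by move=> a c e; apply/permP => y; apply: inj_i; rewrite -!ext_permE e.
Qed.

Lemma plen_ext c : plen (ext_perm c) = plen c.
Proof.
elim/plen_ind: c => [|c y cy IH]; first by rewrite ext_perm1 !plen1.
rewrite (plen_move cy) (@plen_move _ (ext_perm c) (i y)) ext_permE ?(inj_eq inj_i) //.
by rewrite -IH ext_permM ext_tperm.
Qed.

Lemma geodesic_ext c a : geodesic (ext_perm c) (ext_perm a) = geodesic c a.
Proof. by rewrite /geodesic -ext_permV -ext_permM !plen_ext. Qed.

Lemma porbit_ext c y z :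
  (porbit (ext_perm c) (i y) == porbit (ext_perm c) (i z)) = (porbit c y == porbit c z).
Proof.
rewrite !eq_porbit_mem; apply/porbitP/porbitP => -[n] => [|->]; last first.
  by exists n; rewrite -ext_permX ext_permE.
by rewrite -ext_permX ext_permE => /inj_i; exists n.
Qed.

Lemma ext_perm_on b : perm_on (i @: [set: T']) b -> exists c, b = ext_perm c.
Proof.
move=> bD; pose f y := odflt y [pick z | i z == b (i y)].
have fE y : i (f y) = b (i y).
  rewrite /f; case: pickP => [z /eqP//|no].
  have : b (i y) \in i @: [set: T'] by rewrite (perm_closed _ bD) imset_f ?inE.
  by case/imsetP => z _ e; have := no z; rewrite e eqxx.
have f_inj : injective f.
  by move=> y z e; apply: inj_i; apply: (@perm_inj _ b); rewrite -!fE e.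
exists (perm f_inj); apply: ext_perm_eq => [y|x xi]; first by rewrite permE fE.
by rewrite (out_perm bD) //; apply: contra xi => /imsetP[y _ ->]; rewrite codom_f.
Qed.

(** A geodesic moves no point fixed by the target, so it stays in the image of [i] and is itself an
    extension. *)
Lemma sum_geodesic_ext (A : zmodType) c (F : {perm T} -> A) :
  \sum_(b | geodesic (ext_perm c) b) F b = \sum_(a | geodesic c a) F (ext_perm a).
Proof.
transitivity (\sum_(b in ext_perm @: [set a | geodesic c a]) F b).
  apply: eq_bigl => b; apply/idP/imsetP => [gb|[a]]; last first.
    by rewrite inE => ga ->; rewrite geodesic_ext.
  have [|a ba] := @ext_perm_on b; last first.
    by exists a => //; rewrite inE -geodesic_ext -ba.
  apply: geodesic_on gb _; apply/subsetP => x; rewrite inE; apply: contraR => xi.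
  apply/eqP/ext_perm_out; apply: contra xi => /codomP[y ->].
  by rewrite imset_f ?inE.
rewrite big_imset /=; last by move=> a b _ _; exact: ext_perm_inj.
by apply: eq_bigl => a; rewrite inE.
Qed.

Lemma pair_sum_ext (A : comNzRingType) m (p q : 'I_m.+1 -> A) c a :
  pair_sum p q (i @: [set: T']) (ext_perm c) (ext_perm a) = pair_sum p q setT c a.
Proof.
rewrite /pair_sum graph_sum_imset; apply: eq_graph_sum => y z _ _ /=.
  exact: porbit_ext.
by rewrite -ext_permV -ext_permM; exact: porbit_ext.
Qed.

End Extend.

Section FreeCumulant.
Variables (A : comNzRingType) (m : nat) (p q : 'I_m.+1 -> A).

Definition pair_weight k (a b : 'S_k) : A :=
  graph_sum p q setT (porbit a) (porbit b).

(** The series [free_cumulant] cut down to finitely many colours and evaluated at weights in [A]. *)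
Definition free_cum (j : nat) : A :=
  let l := j.-1 in
  \sum_(a : 'S_l) \sum_(b : 'S_l |
      (a * b == perm (@ordS_inj l))%g &&
      (#|porbits a| + #|porbits b| == l.+1)%N)
    (-1) ^+ #|porbits a|.+1 * pair_weight a b.

Lemma sign_porbits k (a : 'S_k) :
  (-1) ^+ #|porbits a|.+1 = (-1) ^+ k.+1 * (-1) ^+ plen a :> A.
Proof.
rewrite -exprD -[LHS]signr_odd -[RHS]signr_odd; congr (_ ^+ nat_of_bool _).
have := congr1 odd (plenK a); rewrite card_ord /nporb /= !oddD /= => <-.
by case: (odd (plen a)); case: (odd _).
Qed.

(** Letters of [l] are numbered by position. For a long cycle, having size l + 1 orbits in total is
    the equality of lengths in [geodesic]. *)
Lemma tree_sumE (T : finType) (l : seq T) : uniq l -> l != [::] ->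
  tree_sum p q l = (-1) ^+ (size l).+1 * free_cum (size l).+1.
Proof.
move=> ul l0; have x0 : T by case: (l) l0.
pose i (k : 'I_(size l)) := nth x0 l k.
have inj_i : injective i.
  by move=> j k /eqP; rewrite nth_uniq // => /eqP/val_inj.
set c := perm (@ordS_inj (size l)).
have cE : pcycle l = ext_perm inj_i c.
  apply: ext_perm_eq => [k|x xi]; first by rewrite /i pcycle_nth // permE.
  apply: pcycle_out; apply: contra xi => xl.
  have kl : (index x l < size l)%N by rewrite index_mem.
  by apply/codomP; exists (Ordinal kl); rewrite /i /= nth_index.
have lE : [set x in l] = i @: [set: 'I_(size l)].
  apply/setP => x; rewrite inE; apply/idP/imsetP => [xl|[k _ ->]]; last exact: mem_nth.
  have kl : (index x l < size l)%N by rewrite index_mem.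
  by exists (Ordinal kl); rewrite ?inE // /i /= nth_index.
have plc : plen c = (size l).-1 by rewrite -(plen_ext inj_i) -cE plen_pcycle.
rewrite /tree_sum lE cE sum_geodesic_ext /free_cum mulr_sumr big_mkcond.
apply: eq_bigr => a _; rewrite pair_sum_ext plen_ext.
rewrite (eq_bigl (fun b => (b == a^-1 * c)%g && geodesic c a)); last first.
  move=> b /=; rewrite -/c; have -> : (a * b == c)%g = (b == a^-1 * c)%g.
    by apply/eqP/eqP => [<-|->]; rewrite ?mulKg ?mulKVg.
  apply: andb_id2l => /eqP ->; rewrite /geodesic plc.
  have := plenK a; have := plenK (a^-1 * c)%g; rewrite card_ord /nporb.
  have : (0 < size l)%N by rewrite lt0n size_eq0.
  move: (plen _) (plen _) #|_| #|_| => n1 n2 n3 n4; case: (size l) => [|n]; lia.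
case: ifP => _; last by rewrite big_pred0 ?mulr0 // => b; rewrite andbF.
rewrite (big_pred1 (a^-1 * c)%g) => [|b]; last by rewrite andbT.
by rewrite sign_porbits !mulrA -exprD -[_ ^+ (_ + _)]signr_odd addnn odd_double mul1r.
Qed.

End FreeCumulant.

(** * Recursion for chains of trees *)

Section Values.
Variable A : comNzRingType.

(** The absolute part of [cut_sum] in terms of the lengths of k, u, v, w. The closing letter [z] and
    the shift between edges and cumulant index account for the 2. *)
Fixpoint cut_val (R : nat -> A) (nk nu nv nw : nat) : A :=
  if nu is nu'.+1 then
    cut_val R nk.+1 nu' nv nw +
    \sum_(i < nw) R (nk + (nw - i.+1)).+2 * cut_val R 0 nu' nv i
  else R (nk + nv + nw).+2.

Variables (m : nat) (p q : 'I_m.+1 -> A) (T : finType).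
Let R := free_cum p q.

Lemma cut_sumE k u v w (z : T) : uniq (k ++ u ++ v ++ rcons w z) ->
  cut_sum p q k u v w z =
  (-1) ^+ (size k + size u + size v + size w) * cut_val R (size k) (size u) (size v) (size w).
Proof.
elim: u k w z => [|e u IH] k w z ul.
  rewrite cut_sum_nil tree_sumE //; last by case: (k) => //; case: (v) => //; case: (w).
  have -> : size (k ++ v ++ rcons w z) = (size k + size v + size w).+1.
    by rewrite !size_cat size_rcons !addnS addnA.
  by rewrite !exprS !mulN1r opprK /= addn0.
rewrite cut_sum_cons // IH ?cat_rcons //= size_rcons mulrDr mulr_sumr.
congr (_ + _); first by rewrite addSn addnS.
apply: eq_bigr => i _.
have wE : rcons w z = rcons (take i w) (nth e w i) ++ rcons (drop i.+1 w) z.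
  by rewrite cat_rcons -rcons_cons -drop_nth // -rcons_cat cat_take_drop.
rewrite tree_sumE; last 2 first.
- apply: subseq_uniq ul; apply: cat_subseq => //.
  rewrite wE !catA; exact: suffix_subseq.
- by case: (k) => //; case: (drop _ _).
rewrite IH; last first.
  apply: subseq_uniq ul; rewrite /= wE; apply: subseq_trans (suffix_subseq k _).
  apply: subseq_trans (subseq_cons _ e); rewrite !catA; exact: prefix_subseq.
rewrite size_cat size_rcons size_drop size_take ltn_ord addnS mulrACA -exprD.
congr (_ * _); congr (_ ^+ _); have := ltn_ord i; rewrite /= add0n.
by move: (size k) (size u) (size v) (size w) (nat_of_ord i) => a b c d f; lia.
Qed.

End Values.

Section Two.
Variables (A : comNzRingType) (m : nat) (p q : 'I_m.+1 -> A).
Variables (T : finType) (ls lr : seq T).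
Hypotheses (ul : uniq (ls ++ lr)) (lT : forall x, x \in ls ++ lr).
Hypotheses (ls0 : ls != [::]) (lr0 : lr != [::]).
Let s := (pcycle ls * pcycle lr)%g.
Let R := free_cum p q.

Lemma setTE : [set x in ls ++ lr] = setT.
Proof. by apply/setP => x; rewrite !inE lT. Qed.

Lemma crossing_compl (a : {perm T}) :
  crossing a ls lr = [set e in [set x in ls] | a^-1%g e \notin [set x in ls]].
Proof. by apply/setP => e; rewrite !inE (mem_compl ul lT). Qed.

Lemma sum_transitive :
  \sum_(a : {perm T} | (plen a + plen (a^-1 * s)%g == (plen s).+2)%N &&
                       (crossing a ls lr != set0))
    (-1) ^+ plen a * pair_sum p q setT s a =
  (-1) ^+ (size ls + size lr).+1 *
  ((size lr)%:R * \sum_(j < size ls) cut_val R 0 (size ls - j.+1) j (size lr).-1).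
Proof.
(* On the left nothing is cut; in the first term on the right all sets of crossing edges are. Pairs
   without crossing edges contribute equally to both. For the others the cuts cancel by
   [loop_relation], which leaves their intact weight. *)
have e0 : annular_sum p q ls [::] lr = annular_sum p q [::] ls lr +
   \sum_(a : {perm T} | (plen a + plen (a^-1 * s)%g == (plen s).+2)%N &&
                       (crossing a ls lr != set0))
    (-1) ^+ plen a * pair_sum p q setT s a.
  rewrite /annular_sum cats0 /= -/s setTE.
  rewrite big_mkcondr -big_split; apply: eq_bigr => a _ /=.
  rewrite signed_cuts_nil; have [cr0|cr0] := eqVneq (crossing a ls lr) set0.
    rewrite addr0; congr (_ * _); rewrite /signed_cuts cr0 (big_pred1 set0) => [|E].
      by rewrite cards0 mul1r setD0.
    by rewrite /= subset0.
  rewrite /signed_cuts; under [in RHS]eq_bigr do rewrite setTD.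
  rewrite crossing_compl loop_relation ?mulr0 ?add0r -?crossing_compl //.
  by move=> x; rewrite !inE (two_cycles_closed ul lT).
have := annular_sum_cat p q (k := [::]) ul; rewrite cat0s e0.
set B := \sum_(a | _) _; set X := annular_sum _ _ _ _ _; set J := \sum_(j < _) _.
move=> eJ; have -> : B = - J.
  by apply/eqP; rewrite -addr_eq0; apply/eqP/(addrI X); rewrite addr0 addrA -eJ.
rewrite exprS mulN1r mulNr mulr_sumr mulr_sumr; congr (- _); apply: eq_bigr => j _.
(* The value does not depend on the position [i] of the predecessor, whence the factor [size lr]. *)
rewrite mulrA (eq_bigr (fun=> (-1) ^+ (size ls + size lr) *
    cut_val R 0 (size ls - j.+1) j (size lr).-1)) => [|i _].
  by rewrite sumr_const card_ord -[_ *+ _]mulr_natl mulrA (mulrC _%:R).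
have x0 : T by case: (ls) ls0.
rewrite (drop_nth x0) //; set e := nth x0 ls j; set g := nth e lr i.
have perm_l : perm_eq (ls ++ lr)
    (e :: drop j.+1 ls ++ take j ls ++ rcons (drop i.+1 lr ++ take i lr) g).
  rewrite perm_sym -cat_cons catA; apply: perm_cat.
    rewrite perm_catC -cat_rcons -cats1 -catA /=.
    by rewrite /e -drop_nth // cat_take_drop.
  rewrite perm_rcons -cat_cons /g -drop_nth // perm_catC.
  by rewrite cat_take_drop.
have := ul; rewrite (perm_uniq perm_l) cons_uniq => /andP[_ ul2].
rewrite cut_sumE // !size_cat !size_drop !size_take !ltn_ord /= !add0n.
have -> : (size lr - i.+1 + i = (size lr).-1)%N by have := ltn_ord i; lia.
rewrite -[X in X * _ = _]signr_odd -[X in _ = X * _]signr_odd.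
congr (_ ^+ nat_of_bool _ * _).
have := ltn_ord i; have := ltn_ord j.
move: (size ls) (size lr) (nat_of_ord i) (nat_of_ord j) => a b c d; lia.
Qed.

End Two.

(** * Generating polynomials of chains *)

Section Closed.
Variables (A : comNzRingType) (R : nat -> A) (r s : nat).

(* One link of a chain: the sum of R_(n + k) over links taking n edges of the first
   face and k of the second; c forces k > c. *)
Definition chain_poly (c : nat) : {poly {poly A}} :=
  \poly_(k < s.+1) \poly_(n < r.+1) (if (c < k)%N && (0 < n)%N then R (n + k)%N else 0).

Lemma coef_chain_poly c k n : (chain_poly c)`_k`_n =
  if [&& (k <= s)%N, (n <= r)%N, (c < k)%N & (0 < n)%N] then R (n + k)%N else 0.
Proof.
rewrite coef_poly ltnS; case: ifP => ks; last by rewrite coef0.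
by rewrite coef_poly ltnS; case: ifP.
Qed.

Let F := chain_poly 0.

(** [b] counts the edges of [u] passed over before the next cut; the first term is the case of no
    further cut. *)
Lemma cut_val_unroll nk nu nv nw : cut_val R nk nu nv nw =
  R (nk + nu + nv + nw).+2 +
  \sum_(b < nu) \sum_(i < nw)
     R (nk + b + (nw - i.+1)).+2 * cut_val R 0 (nu - b.+1) nv i.
Proof.
elim: nu nk => [|nu IH] nk; first by rewrite big_ord0 addr0 addn0.
rewrite [LHS]/= IH big_ord_recl /= subn1 /= addn0 addSn addnS -addrA; congr (_ + _).
rewrite addrC; congr (_ + _).
by apply: eq_bigr => b _; apply: eq_bigr => i _; rewrite addSn addnS.
Qed.

Lemma sum_ord_shift (V : zmodType) (f : nat -> V) K n : (n <= K)%N ->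
  f 0%N = 0 -> (forall i, (n < i)%N -> f i = 0) ->
  \sum_(i < K.+1) f i = \sum_(i < n) f i.+1.
Proof.
move=> nK f0 fn; rewrite -(big_mkord xpredT f) big_ltn // f0 add0r.
rewrite big_add1 /= (big_cat_nat _ nK) //= [X in _ + X]big_nat_cond [X in _ + X]big1 => [|i].
  by rewrite addr0 big_mkord.
by rewrite andbT => /andP[ni _]; apply: fn.
Qed.

(** The last link contains all of [v] and the first deleted edge, so it takes more than [nv] edges:
    this is [chain_poly nv]. Each of the [t] other links takes at least one edge of [u], hence
    [t <= nu < M]. The two successors count the first deleted edge and its predecessor. *)
Lemma cut_val_coef nu nv nw M : (nu + nv < s)%N -> (nw < r)%N -> (nu < M)%N ->
  cut_val R 0 nu nv nw =
  (\sum_(t < M) F ^+ t * chain_poly nv)`_(nu + nv).+1`_nw.+1.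
Proof.
elim/ltn_ind: nu nw M => nu IH nw [//|M] nus nwr nuM.
set H := fun M' => \sum_(t < M') F ^+ t * chain_poly nv.
have H0 M' k n : (k <= nv)%N || (n == 0)%N -> (H M')`_k`_n = 0.
  move=> kn; rewrite /H coef_sum coef_sum big1 // => t _; rewrite coefM coef_sum big1 // => i _.
  rewrite coefM big1 // => j _; rewrite [X in _ * X]coef_chain_poly.
  case: ifP; rewrite ?mulr0 // => /and4P[_ _].
  case/orP: kn => [|/eqP n0 _ h]; last first.
    by exfalso; move: (leq_trans h (leq_subr j n)); rewrite n0.
  by move=> knv h; have := ltn_ord i; have := leq_ltn_trans (leq_trans (leq_subr i k) knv) h; rewrite ltnn.
rewrite -/(H M.+1); have -> : H M.+1 = chain_poly nv + F * H M.
  rewrite /H big_ord_recl expr0 mul1r mulr_sumr; congr (_ + _).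
  by apply: eq_bigr => t _; rewrite exprS mulrA.
rewrite cut_val_unroll coefD coefD coef_chain_poly; congr (_ + _).
  rewrite nus nwr /= ltnS leq_addl !add0n addSn !addnS.
  by rewrite addnC.
rewrite coefM coef_sum.
rewrite (@sum_ord_shift _ (fun i => (F`_i * (H M)`_((nu + nv).+1 - i))`_nw.+1) _ nu).
- apply: eq_bigr => b _; rewrite coefM.
  rewrite (@sum_ord_shift _ (fun j => F`_b.+1`_j * (H M)`_((nu + nv).+1 - b.+1)`_(nw.+1 - j)) _ nw).
  + rewrite (reindex_inj rev_ord_inj) /=; apply: eq_bigr => i _.
    have bnu := ltn_ord b; have inw := ltn_ord i.
    rewrite (IH (nu - b.+1)%N _ (nw - i.+1)%N M) -/(H M); first last.
    * by lia.
    * by lia.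
    * by lia.
    * by lia.
    have -> : ((nu + nv).+1 - b.+1 = (nu - b.+1 + nv).+1)%N by lia.
    have -> : (nw.+1 - i.+1 = (nw - i.+1).+1)%N by lia.
    congr (_ * _); rewrite coef_chain_poly.
    have -> : [&& (b < s)%N, (i < r)%N, (0 < b.+1)%N & (0 < i.+1)%N] by lia.
    by congr R; lia.
  + by lia.
  + by rewrite coef_chain_poly !andbF mul0r.
  + by move=> j nj; rewrite H0 ?mulr0 // orbC; have -> : (nw.+1 - j = 0)%N by lia.
- by lia.
- suff -> : F`_0 = 0 by rewrite mul0r coef0.
  by apply/polyP => n; rewrite coef_chain_poly coef0 /= andbF.
- move=> i nui; rewrite coefM big1 // => j _; rewrite H0 ?mulr0 //; lia.
Qed.

(** A link with k edges on the face being cut occurs for each j < k, that is, once for each place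
    the first deleted edge can have in it. *)
Lemma sum_chain_poly : \sum_(j < s) chain_poly j = 'X * F^`().
Proof.
apply/polyP => k; apply/polyP => n.
rewrite !coef_sum coefXM; case: k => [|k] /=.
  by rewrite coef0 big1 // => j _; rewrite coef_chain_poly ltn0 !andbF.
rewrite coef_deriv coefMn coef_chain_poly.
under eq_bigr do rewrite coef_chain_poly.
case: (boolP [&& (k < s)%N, (n <= r)%N, (0 < k.+1)%N & (0 < n)%N]); last first.
  move=> h; rewrite mul0rn big1 // => j _; case: ifP => // /and4P[h1 h2 _ h4].
  by case/negP: h; rewrite h1 h2 h4.
case/and4P => ks nr _ n0.
under eq_bigr do rewrite ks nr n0 /= andbT.
by rewrite -big_mkcond -(big_ord_widen _ (fun=> R (n + k.+1)%N) ks) sumr_const card_ord.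
Qed.

(** Both sides are the coefficient of x (F^(t+1))': this trades the marked edge for the factor s /
    (t+1). *)
Lemma chain_deriv t : (F ^+ t * ('X * F^`()))`_s`_r *+ t.+1 = (F ^+ t.+1)`_s`_r *+ s.
Proof.
rewrite mulrCA coefXM; case: s => [|s'] /=; first by rewrite coef0 mul0rn mulr0n.
have := deriv_exp F t.+1; rewrite /= => e.
rewrite -coefMn -coefMn mulrC -[_ * _ *+ _]e coef_deriv coefMn.
by [].
Qed.

Lemma sum_cut_val : (0 < r)%N ->
  \sum_(j < s) cut_val R 0 (s - j.+1) j r.-1 =
  \sum_(t < s) (F ^+ t * ('X * F^`()))`_s`_r.
Proof.
move=> r0; transitivity (\sum_(j < s) (\sum_(t < s) F ^+ t * chain_poly j)`_s`_r).
  apply: eq_bigr => j _; have js := ltn_ord j.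
  rewrite (@cut_val_coef _ _ _ s) ?prednK //; try lia.
  by have -> : (s - j.+1 + j).+1 = s by lia.
rewrite -sum_chain_poly; under [RHS]eq_bigr do rewrite mulr_sumr !coef_sum.
rewrite exchange_big /=; apply: eq_bigr => j _.
by rewrite !coef_sum.
Qed.

End Closed.

(** * The sum over planar annular maps *)

Lemma pcycle_traject (T : finType) (s : {perm T}) x y : y \in porbit s x ->
  pcycle (traject s x #|porbit s x|) y = s y.
Proof.
set l := traject _ _ _; have ul : uniq l := uniq_traject_porbit s x.
rewrite porbit_traject -/l => yl; rewrite -(nth_index x yl).
have il : (index y l < #|porbit s x|)%N by move: yl; rewrite -index_mem size_traject.
rewrite pcycle_nth ?size_traject // (nth_traject s il).
have pos : (0 < #|porbit s x|)%N := leq_ltn_trans (leq0n _) il.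
have [e|ne] := eqVneq (index y l).+1 #|porbit s x|.
  by rewrite e modnn (nth_traject s pos) -iterS e iter_porbit.
have lt : ((index y l).+1 < #|porbit s x|)%N by rewrite ltn_neqAle ne.
by rewrite modn_small // (nth_traject s lt).
Qed.

Lemma two_cycle_type (T : finType) (s : {perm T}) n1 n2 :
  perm_eq [seq #|c| | c : {set T} in porbits s] [:: n1; n2] ->
  exists l1 l2 : seq T, [/\ uniq (l1 ++ l2), forall x, x \in l1 ++ l2,
    size l1 = n1, size l2 = n2 & s = (pcycle l1 * pcycle l2)%g].
Proof.
wlog : n1 n2 / exists c1 c2, [/\ enum (porbits s) = [:: c1; c2], #|c1| = n1 & #|c2| = n2].
  move=> W ct; have := perm_size ct; rewrite size_image /= => sz.
  move: (ct); rewrite /image_mem; case E: (enum _) => [|c1 [|c2 [|c3 l]]].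
  - by move/perm_size.
  - by move/perm_size.
  - rewrite /= => pe; have := perm_mem pe #|c1|; rewrite mem_head !inE => /esym/orP[]/eqP e.
      have e2 : #|c2| = n2.
        by move: pe; rewrite e perm_cons => /perm_mem/(_ #|c2|); rewrite mem_head inE => /esym/eqP.
      by apply: W => //; exists c1, c2.
    have pe' : perm_eq [seq #|c| | c : {set T} in porbits s] [:: n2; n1].
      by apply: perm_trans ct _; rewrite (perm_catC [:: n1] [:: n2]).
    have e2 : #|c2| = n1.
      move: pe; rewrite e (perm_sym _ [:: n1; _]) (perm_catC [:: n1] [:: n2]) /= perm_cons.
      by move/perm_mem/(_ #|c2|); rewrite !inE eqxx => /eqP.
    have [|l1 [l2 [ul lT s1 s2 sE]]] := W n2 n1 _ pe'; first by exists c1, c2.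
    have dl : [disjoint [set x in l1] & [set x in l2]].
      rewrite disjoint_sym disjoints_subset; apply/subsetP => x; rewrite !inE => x2.
      by move: ul; rewrite cat_uniq => /and3P[_ /hasPn/(_ _ x2)].
    exists l2, l1; split=> //; first by rewrite uniq_catC.
      by move=> x; rewrite mem_cat orbC -mem_cat.
    by rewrite sE (perm_onC (pcycle_on _) (pcycle_on _) dl).
  - by move/perm_size.
case=> c1 [c2 [E <- <-]] _.
have mE c : (c \in porbits s) = (c == c1) || (c == c2).
  by rewrite -mem_enum E !inE.
have /imsetP[x1 _ c1E] : c1 \in porbits s by rewrite mE eqxx.
have /imsetP[x2 _ c2E] : c2 \in porbits s by rewrite mE eqxx orbT.
have ne : c1 != c2 by have := enum_uniq (porbits s); rewrite E /= inE andbT.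
set l1 := traject s x1 #|porbit s x1|; set l2 := traject s x2 #|porbit s x2|.
have m1 y : (y \in l1) = (y \in porbit s x1) by rewrite porbit_traject.
have m2 y : (y \in l2) = (y \in porbit s x2) by rewrite porbit_traject.
have dis y : y \in porbit s x1 -> y \in porbit s x2 -> False.
  rewrite -!eq_porbit_mem -c1E -c2E => /eqP e1 /eqP e2; case/eqP: ne.
  by rewrite -e1 -e2.
have all y : (y \in porbit s x1) || (y \in porbit s x2).
  by rewrite -!eq_porbit_mem -c1E -c2E -mE; apply: imset_f.
exists l1, l2; split.
- rewrite cat_uniq !uniq_traject_porbit andbT; apply/hasPn => y; rewrite m2 => y2.
  by apply/negP; rewrite /= m1 => /dis; apply.
- by move=> y; rewrite mem_cat m1 m2.
- by rewrite size_traject c1E.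
- by rewrite size_traject c2E.
apply/permP => y; rewrite permM.
have [y1|y1] := boolP (y \in porbit s x1).
  rewrite (pcycle_traject y1) pcycle_out // m2; apply/negP; apply: dis.
  by rewrite -eq_porbit_mem porbit_permE eq_porbit_mem.
rewrite (@pcycle_out _ l1) ?m1 // pcycle_traject //.
by move: (all y); rewrite (negPf y1).
Qed.

Section Annular.
Variables (A : comNzRingType) (m : nat) (p q : 'I_m.+1 -> A) (r s : nat).
Hypotheses (r0 : (0 < r)%N) (s0 : (0 < s)%N).

Lemma sum_annular (sg : 'S_(r + s)) :
  perm_eq [seq #|c| | c : {set 'I_(r + s)} in porbits sg] [:: r; s] ->
  \sum_(a : 'S_(r + s)) \sum_(b : 'S_(r + s) | [&& (a * b == sg)%g,
      [transitive <<[set a; b]>>, on [set: 'I_(r + s)] | 'P]%g &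
      (#|porbits a| + #|porbits b| == r + s)%N])
    (-1) ^+ #|porbits a|.+1 * pair_weight p q a b =
  \sum_(t < s) r%:R * ((chain_poly (free_cum p q) r s 0) ^+ t *
                ('X * (chain_poly (free_cum p q) r s 0)^`()))`_s`_r.
Proof.
(* The word that is cut is that of the face of length s; the other one provides the r
   predecessors. *)
move=> ct; have ct' : perm_eq [seq #|c| | c : {set 'I_(r + s)} in porbits sg] [:: s; r].
  by apply: perm_trans ct _; rewrite (perm_catC [:: r] [:: s]).
have [ls [lr [ul lT szs szr sgE]]] := two_cycle_type ct'.
have ls0 : ls != [::] by rewrite -size_eq0 szs -lt0n.
have lr0 : lr != [::] by rewrite -size_eq0 szr -lt0n.
have usr : uniq ls /\ uniq lr by move: ul; rewrite cat_uniq => /and3P[].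
have dl : [disjoint [set x in ls] & [set x in lr]].
  rewrite disjoint_sym disjoints_subset; apply/subsetP => x; rewrite !inE => x2.
  by move: ul; rewrite cat_uniq => /and3P[_ /hasPn/(_ _ x2)].
have plsg : (plen sg).+2 = (r + s)%N.
  rewrite sgE (plen_disjoint (pcycle_on _) (pcycle_on _) dl) !plen_pcycle; try by case: usr.
  by rewrite szs szr; move: r0 s0; lia.
rewrite -mulr_sumr -sum_cut_val //.
have := sum_transitive p q ul lT ls0 lr0; rewrite -sgE szs szr.
move/(congr1 (fun y => (-1) ^+ (r + s).+1 * y)).
have sq n : (-1) ^+ (n + n) = 1 :> A.
  by rewrite addnn -mul2n exprM sqrrN !expr1n.
rewrite [RHS in _ = RHS -> _]mulrA -exprD (addnC s r) sq mul1r => <-.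
rewrite mulr_sumr [RHS]big_mkcond; apply: eq_bigr => a _.
rewrite (eq_bigl (fun b => (b == a^-1 * sg)%g && ((plen a + plen (a^-1 * sg)%g == (plen sg).+2)%N &&
                       (crossing a ls lr != set0)))); last first.
  move=> b /=; have -> : (a * b == sg)%g = (b == a^-1 * sg)%g.
    by apply/eqP/eqP => [<-|->]; rewrite ?mulKg ?mulKVg.
  apply: andb_id2l => /eqP bE.
  rewrite (transitive_crossing ul lT ls0 lr0) -?sgE ?bE ?mulKVg // andbC; congr (_ && _).
  have := plenK a; have := plenK (a^-1 * sg)%g; rewrite card_ord /nporb plsg.
  move: (plen _) (plen _) #|_| #|_| => x1 x2 x3 x4; move: r0 s0; lia.
case: ifP => _; last by rewrite big_pred0 // => b; rewrite andbF.
rewrite (big_pred1 (a^-1 * sg)%g) => [|b]; last by rewrite andbT.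
by rewrite sign_porbits mulrA.
Qed.

End Annular.

(** * Algebraic independence of the free cumulants *)

Section Orbits.
Variables (A : comNzRingType) (m : nat) (p q : 'I_m.+1 -> A) (k : nat).
Implicit Types a b : 'S_k.

Lemma mem_porbits a x : porbit a x \in porbits a.
Proof. exact: imset_f. Qed.

Definition orb a x : orbits a := exist _ (porbit a x) (mem_porbits a x).

Lemma orb_surj a : orb a @: [set: 'I_k]%SET = [set: orbits a]%SET.
Proof.
apply/setP => w; rewrite [RHS]inE; apply/imsetP.
case/imsetP: (valP w) => x _ wE; exists x => //.
exact: val_inj.
Qed.

Lemma pair_weight_orbits a b : pair_weight p q a b =
  \sum_(f : {ffun orbits a -> 'I_m.+1}) \sum_(h : {ffun orbits b -> 'I_m.+1})
    [forall x, (f (orb a x) <= h (orb b x))%N]%:R *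
    (\prod_u p (f u) * \prod_w q (h w)).
Proof.
rewrite /pair_weight (@eq_graph_sum _ _ _ _ _ _ (orbits a) _ (orbits b) _ _ (orb a) _ (orb b)).
- rewrite /graph_sum !orb_surj; apply: eq_big => [f|f _].
    by apply/supp_inP => u; rewrite finset.in_setT.
  apply: eq_big => [h|h _]; first by apply/supp_inP => u; rewrite finset.in_setT.
  congr ((nat_of_bool _)%:R * (_ * _)).
  + by apply/forall_inP/forallP => fh x //; apply: fh; rewrite finset.in_setT.
  + by apply: eq_bigl => u; rewrite finset.in_setT.
  + by apply: eq_bigl => u; rewrite finset.in_setT.
- by move=> x y _ _; rewrite -val_eqE.
- by move=> x y _ _; rewrite -val_eqE.
Qed.

End Orbits.

Lemma rmorph_pair_weight (A B : comNzRingType) (phi : {rmorphism A -> B}) m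
    (p q : 'I_m.+1 -> A) k (a b : 'S_k) :
  phi (pair_weight p q a b) = pair_weight (phi \o p) (phi \o q) a b.
Proof.
rewrite !pair_weight_orbits rmorph_sum; apply: eq_bigr => f _.
rewrite rmorph_sum; apply: eq_bigr => h _.
by rewrite !rmorphM !rmorph_prod rmorph_nat.
Qed.

Lemma rmorph_free_cum (A B : comNzRingType) (phi : {rmorphism A -> B}) m
    (p q : 'I_m.+1 -> A) j :
  phi (free_cum p q j) = free_cum (phi \o p) (phi \o q) j.
Proof.
rewrite /free_cum rmorph_sum; apply: eq_bigr => a _.
rewrite rmorph_sum; apply: eq_bigr => b _.
by rewrite rmorphM rmorphXn rmorphN1 rmorph_pair_weight.
Qed.

Definition transitive_sum (A : comNzRingType) m (p q : 'I_m.+1 -> A) k (sg : 'S_k) : A :=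
  \sum_(a : 'S_k) \sum_(b : 'S_k | (a * b == sg)%g &&
      [transitive <<[set a; b]%SET>>, on [set: 'I_k]%SET | 'P]%g)
    (-1) ^+ #|porbits a|.+1 * pair_weight p q a b.

Lemma rmorph_transitive_sum (A B : comNzRingType) (phi : {rmorphism A -> B}) m
    (p q : 'I_m.+1 -> A) k (sg : 'S_k) :
  phi (transitive_sum p q sg) = transitive_sum (phi \o p) (phi \o q) sg.
Proof.
rewrite /transitive_sum rmorph_sum; apply: eq_bigr => a _.
rewrite rmorph_sum; apply: eq_bigr => b _.
by rewrite rmorphM rmorphXn rmorphN1 rmorph_pair_weight.
Qed.

Lemma card_orbits k (a : 'S_k) : #|{: orbits a}| = #|porbits a|.
Proof. by rewrite card_sig; apply: eq_card => c; rewrite !inE. Qed.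

Section Scale.
Variables (A : comNzRingType) (m : nat) (p q : 'I_m.+1 -> A) (u v : A).

Lemma pair_weight_scale k (a b : 'S_k) :
  pair_weight (fun c => u * p c) (fun c => v * q c) a b =
  u ^+ #|porbits a| * v ^+ #|porbits b| * pair_weight p q a b.
Proof.
rewrite !pair_weight_orbits mulr_sumr; apply: eq_bigr => f _.
rewrite mulr_sumr; apply: eq_bigr => h _.
rewrite [RHS]mulrCA; congr (_ * _); rewrite !big_split !prodr_const /= mulrACA.
by congr (_ ^+ _ * _ ^+ _ * _); rewrite -card_orbits; apply: eq_card.
Qed.

End Scale.

Lemma long_cycleE n : perm (@ordS_inj n) = pcycle (enum 'I_n).
Proof.
apply/permP => i; rewrite permE -{2}(nth_ord_enum i i).
rewrite pcycle_nth ?enum_uniq ?size_enum_ord //; apply: val_inj => /=.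
by rewrite nth_enum_ord // ltn_mod (leq_ltn_trans _ (ltn_ord i)).
Qed.

Lemma plen_long_cycle n : plen (perm (@ordS_inj n)) = n.-1.
Proof. by rewrite long_cycleE plen_pcycle ?enum_uniq // size_enum_ord. Qed.

Section Linear.
Variables (A : comNzRingType) (m : nat) (p q : 'I_m.+1 -> A).

(** There is a single white vertex, and each of the l + 1 black ones is free above its colour. *)
Lemma pair_weight_star l : pair_weight p q (perm (@ordS_inj l.+1)) 1%g =
  \sum_c p c * (\sum_(d : 'I_m.+1 | (c <= d)%N) q d) ^+ l.+1.
Proof.
rewrite /pair_weight (@eq_graph_sum _ _ _ _ _ _ unit _ 'I_l.+1 _ _ (fun=> tt) _ id); first last.
- by move=> x y _ _; rewrite !porbit_fix ?perm1 // (inj_eq set1_inj).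
- move=> x y _ _; rewrite eqxx long_cycleE eq_porbit_mem.
  by rewrite porbit_pcycle ?enum_uniq ?mem_enum.
have i1 : [set tt | x in [set: 'I_l.+1]] = setT :> {set unit}.
  by apply/setP => -[]; rewrite !inE; apply/imsetP; exists ord0.
rewrite /graph_sum i1 imset_id.
transitivity (\sum_(f : {ffun unit -> 'I_m.+1}) p (f tt) *
    (\sum_(d : 'I_m.+1 | (f tt <= d)%N) q d) ^+ l.+1).
  apply: eq_big => [f|f _]; first by apply/supp_inP => u; rewrite in_setT.
  have -> : (\sum_(d : 'I_m.+1 | (f tt <= d)%N) q d) ^+ l.+1 =
     \prod_(i < l.+1) \sum_(d : 'I_m.+1) ((f tt <= d)%N%:R * q d).
    rewrite prodr_const card_ord; congr (_ ^+ _); rewrite big_mkcond.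
    by apply: eq_bigr => d _; case: ifP; rewrite ?mul1r ?mul0r.
  rewrite bigA_distr_bigA mulr_sumr; apply: eq_big => [h|h _].
    by apply/supp_inP => u; rewrite in_setT.
  rewrite (big_pred1 tt) => [|[]]; last by rewrite in_setT.
  rewrite mulrCA; congr (_ * _).
  rewrite (eq_bigl xpredT) => [|i]; last by rewrite in_setT.
  rewrite big_split /=; congr (_ * _).
  case: forallP => [fh|nfh].
    by rewrite big1 // => i _; rewrite (implyP (fh i)) ?in_setT.
  have [i fh] : exists i, ~~ (f tt <= h i)%N.
    apply/existsP; rewrite -negb_forall; apply/negP => /forallP fh.
    by case: nfh => i; apply/implyP.
  by rewrite (bigD1 i) //= (negPf fh) mul0r.
rewrite (reindex (fun c : 'I_m.+1 => [ffun=> c] : {ffun unit -> 'I_m.+1})) /=.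
  by apply: eq_bigr => c _; rewrite ffunE.
exists (fun f : {ffun unit -> 'I_m.+1} => f tt) => [c _|f _]; first by rewrite ffunE.
by apply/ffunP => -[]; rewrite ffunE.
Qed.

Lemma plen_eq0 (T : finType) (s : {perm T}) : plen s = 0%N -> s = 1%g.
Proof. by move: s; apply: plen_ind => // s x sx _; rewrite (plen_move sx). Qed.

Lemma porbits_gt0 l (a : 'S_l.+1) : (0 < #|porbits a|)%N.
Proof. by rewrite (cardD1 (porbit a ord0)) mem_porbits. Qed.

(** The cumulant at [X * p] divided by [X], each term having a white vertex; at [X = 0] its part
    linear in p remains. *)
Definition reduced_cum (X : A) (j : nat) : A :=
  let l := j.-1 in
  \sum_(a : 'S_l) \sum_(b : 'S_l |
      (a * b == perm (@ordS_inj l))%g &&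
      (#|porbits a| + #|porbits b| == l.+1)%N)
    (-1) ^+ #|porbits a|.+1 * (X ^+ #|porbits a|.-1 * pair_weight p q a b).

Lemma free_cum_scale X j :
  free_cum (fun c => X * p c) q j.+2 = X * reduced_cum X j.+2.
Proof.
rewrite /free_cum mulr_sumr; apply: eq_bigr => a _; rewrite mulr_sumr.
apply: eq_bigr => b _; have qE : q = (fun c => 1 * q c).
  by apply/boolp.funext => c; rewrite mul1r.
rewrite {1}qE pair_weight_scale expr1n mulr1 [RHS]mulrCA; congr (_ * _); rewrite mulrA -exprS.
by rewrite prednK // porbits_gt0.
Qed.

Lemma reduced_cum0 j : reduced_cum 0 j.+2 =
  \sum_c p c * (\sum_(d : 'I_m.+1 | (c <= d)%N) q d) ^+ j.+1.
Proof.
rewrite -pair_weight_star /reduced_cum /=; set c := perm _.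
have plc : plen c = j by rewrite plen_long_cycle.
have pc : #|porbits c| = 1%N.
  by have := plenK c; rewrite plc card_ord /nporb; lia.
have p1 : #|porbits (1%g : 'S_j.+1)| = j.+1.
  by have := plenK (1%g : 'S_j.+1); rewrite plen1 card_ord.
rewrite (bigD1 c) //= (big_pred1 1%g) => [|b]; last first.
  have -> : (c * b == c)%g = (b == 1%g) by rewrite -{2}[c]mulg1 (inj_eq (mulgI c)).
  by rewrite /= andb_idr // => /eqP ->; rewrite pc p1.
rewrite pc expr0 mul1r sqrrN expr1n mul1r big1 ?addr0 // => a ac.
rewrite big1 // => b /andP[/eqP ab /eqP pab].
(* A second white vertex brings a factor 0. With a single one, the orbit count forces [b = 1], so
   [a] is the long cycle already taken out. *)
have [a1|a1] := eqVneq #|porbits a| 1%N; last first.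
  rewrite expr0n (_ : (_.-1 == 0)%N = false) ?mul0r ?mulr0 //.
  by have := porbits_gt0 a; move: a1; case: #|_| => [|[]].
case/eqP: ac; rewrite -ab (@plen_eq0 _ b) ?mulg1 //.
have := plenK b; rewrite card_ord /nporb; move: pab; rewrite a1.
by move: (plen b) #|porbits b| => x y; lia.
Qed.

End Linear.

Lemma rmorph_reduced_cum (A B : comNzRingType) (phi : {rmorphism A -> B}) m
    (p q : 'I_m.+1 -> A) X j :
  phi (reduced_cum p q X j) = reduced_cum (phi \o p) (phi \o q) (phi X) j.
Proof.
rewrite /reduced_cum rmorph_sum; apply: eq_bigr => a _.
rewrite rmorph_sum; apply: eq_bigr => b _.
by rewrite !rmorphM !rmorphXn rmorphN1 rmorph_pair_weight.
Qed.

(** At q = 1 the linear part of R_(i+2) has coefficient (m+1-c)^(i+1) at p_c. These nodes are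
    distinct and nonzero in characteristic 0, so a Vandermonde determinant gives the inverse. *)
Lemma power_sum_inverse (C : numFieldType) m :
  exists W : 'M[C]_m.+1, forall i j : 'I_m.+1,
    \sum_(c < m.+1) (m.+1 - c)%:R ^+ i.+1 * W c j = (i == j)%:R.
Proof.
pose x : 'rV[C]_m.+1 := \row_c (m.+1 - c)%:R.
pose V : 'M[C]_m.+1 := \matrix_(i, c) (x 0 c) ^+ i.+1.
have Vu : V \in unitmx.
  have -> : V = Vandermonde m.+1 x *m diag_mx x.
    apply/matrixP => i c; rewrite mul_mx_diag !mxE.
    by rewrite exprSr.
  rewrite unitmx_mul !unitmxE det_Vandermonde det_diag !unitfE.
  apply/andP; split; apply/prodf_neq0 => i _; last first.
    by rewrite mxE pnatr_eq0 subn_eq0 -ltnNge.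
  apply/prodf_neq0 => c ic; rewrite !mxE subr_eq0 eqr_nat.
  by have := ltn_ord i; have := ltn_ord c; move: ic; lia.
exists (invmx V) => i j; have := congr1 (fun M : 'M_m.+1 => M i j) (mulmxV Vu).
by rewrite !mxE => <-; apply: eq_bigr => c _; rewrite !mxE.
Qed.

(** With as many colours as cumulants, p can be chosen so that the linear parts of the cumulants
    become independent variables. The terms of [D] of least ordinary degree then stand alone in the
    lowest power of X. *)
Lemma free_cum_independent (C : numFieldType) k (k0 : (0 < k)%N) (D : {mpoly C[k]}) :
  (forall (A : comNzRingType) (f : {rmorphism C -> A}) (p q : 'I_k.-1.+1 -> A),
    mmap f (fun i => free_cum p q i.+2) D = 0) -> D = 0.
Proof.
case: k k0 D => // m _ D hD; have [W WE] := power_sum_inverse C m.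
pose A0 : comNzRingType := {mpoly C[m.+1]}.
pose l (c : 'I_m.+1) : A0 := \sum_(j < m.+1) W c j *: 'X_j.
pose G (i : 'I_m.+1) : {poly A0} :=
  reduced_cum (fun c => (l c)%:P) (fun=> 1) 'X i.+2.
have G0 i : (G i)`_0 = 'X_i.
  have -> : (G i)`_0 = horner_eval 0 (G i) by rewrite /horner_eval horner_coef0.
  rewrite /G rmorph_reduced_cum /= /horner_eval hornerX reduced_cum0.
  have -> : 'X_i = \sum_(j < m.+1) (i == j)%:R *: 'X_j :> A0.
    rewrite (bigD1 i) //= eqxx scale1r big1 ?addr0 // => j /negPf.
    by rewrite eq_sym => ->; rewrite scale0r.
  under [RHS]eq_bigr do rewrite -WE scaler_suml.
  rewrite exchange_big; apply: eq_bigr => c _; rewrite /= hornerC /l mulr_suml.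
  apply: eq_bigr => j _.
  have -> : \sum_(d : 'I_m.+1 | (c <= d)%N) (1 : {poly A0}).[0] = ((m.+1 - c)%:R : C)%:MP.
    rewrite (eq_bigr (fun=> 1)) => [|d _]; last by rewrite hornerC.
    rewrite sumr_const rmorph_nat; congr (_ *+ _).
    transitivity (\sum_(c <= d < m.+1) 1)%N; last by rewrite sum_nat_const_nat muln1.
    by rewrite (big_nat_widenl c 0) //= big_mkord sum1_card.
  rewrite -rmorphXn /= mulrC mul_mpolyC scalerA.
  by [].
have := hD {poly A0} (polyC \o @mpolyC _ C) (fun c => 'X * (l c)%:P) (fun=> 1).
apply: contra_eq => D0.
have [e0 e0D] : exists e, e \in msupp D.
  by case E: (msupp D) => [|e s]; [rewrite -msupp_eq0 E in D0|exists e; rewrite mem_head].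
have [e1 e1D e1min] : exists2 e1, e1 \in msupp D & forall e, e \in msupp D -> (mdeg e1 <= mdeg e)%N.
  have exP : exists d, has (fun e => mdeg e == d) (msupp D).
    by exists (mdeg e0); apply/hasP; exists e0.
  case: (ex_minnP exP) => d /hasP[e1 e1D /eqP e1d] dmin; exists e1 => // e eD.
  by rewrite e1d dmin //; apply/hasP; exists e.
(* With q = 1 and p = 'X * l, R_(i + 2) is 'X * ('X_i + O('X)). *)
apply/eqP => /(congr1 (fun z : {poly A0} => (z`_(mdeg e1))@_e1)).
rewrite coef0 mcoeff0 /mmap coef_sum raddf_sum /=.
rewrite (eq_big_seq (fun e => if mdeg e == mdeg e1 then D@_e * (e == e1)%:R else 0)).
  rewrite (bigD1_seq e1) ?msupp_uniq //= !eqxx mulr1 big1 ?addr0 => [/eqP|e /negPf ->].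
    by rewrite mcoeff_eq0 e1D.
  by rewrite mulr0 if_same.
move=> e eD; have -> : mmap1 (fun i : 'I_m.+1 =>
    free_cum (fun c => 'X * (l c)%:P) (fun=> 1) i.+2) e = 'X^(mdeg e) * mmap1 G e.
  rewrite /mmap1 mdegE -prodrXr -big_split; apply: eq_bigr => i _ /=.
  by rewrite free_cum_scale exprMn.
rewrite mulrCA coefXnM; have := e1min e eD; rewrite leq_eqVlt eq_sym.
case: ltngtP => // [_ _|->]; first by rewrite mcoeff0.
rewrite subnn coefCM mcoeffCM => _; congr (_ * _).
have -> : (mmap1 G e)`_0 = 'X_[e].
  rewrite -horner_coef0 -[_.[0]]/(horner_eval 0 _) /mmap1 rmorph_prod -mmap1_id.
  by apply: eq_bigr => i _; rewrite rmorphXn /= /horner_eval horner_coef0 G0.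
by rewrite mcoeffX.
Qed.

(** * Counting annular chains *)

Section Agree.
Variables (A : comNzRingType) (r s : nat).
Implicit Types F G : {poly {poly A}}.

(** [chain_poly] is truncated and products of windows are not. The coefficient at (s, r) of a
    product sees only lower coefficients of its factors, so the difference is harmless. *)
Definition agree F G := forall k n, (k <= s)%N -> (n <= r)%N -> F`_k`_n = G`_k`_n.

Lemma agreeM F F' G G' : agree F F' -> agree G G' -> agree (F * G) (F' * G').
Proof.
move=> FF' GG' k n ks nr; rewrite !coefM !coef_sum; apply: eq_bigr => i _.
rewrite !coefM; apply: eq_bigr => j _; rewrite FF' ?GG' //.
- exact: leq_trans (leq_subr _ _) ks.
- exact: leq_trans (leq_subr _ _) nr.
- by rewrite (leq_trans _ ks) // -ltnS ltn_ord.
- by rewrite (leq_trans _ nr) // -ltnS ltn_ord.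
Qed.

Lemma agreeX F G t : agree F G -> agree (F ^+ t) (G ^+ t).
Proof.
move=> FG; elim: t => [|t IH]; first by rewrite !expr0.
by rewrite !exprS; apply: agreeM.
Qed.

End Agree.

Lemma rmorph_chain_poly (A B : comNzRingType) (phi : {rmorphism A -> B})
    (R : nat -> A) (R' : nat -> B) r s t k n :
  (forall j, (1 < j)%N -> (j <= r + s)%N -> phi (R j) = R' j) ->
  (chain_poly R' r s 0 ^+ t)`_k`_n = phi ((chain_poly R r s 0 ^+ t)`_k`_n).
Proof.
move=> RR'; suff -> : chain_poly R' r s 0 = map_poly (map_poly phi) (chain_poly R r s 0).
  by rewrite -rmorphXn /= coef_map /= coef_map.
apply/polyP => k'; apply/polyP => n'; rewrite !coef_map /= !coef_chain_poly.
case: ifP => [/and4P[h1 h2 h3 h4]|]; rewrite ?rmorph0 // RR' //; lia.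
Qed.

Section Windows.
Variables (A : comNzRingType).

(** The ways of sharing the i + 2 edges of a link between the two faces, at least one for each; the
    inner variable counts the face of length r. *)
Definition window (i : nat) : {poly {poly A}} :=
  \sum_(x < i.+1) ('X^(x.+1))%:P * 'X^((i - x).+1).

Lemma coef_window i k n : (window i)`_k`_n =
  [&& (0 < k)%N, (0 < n)%N & (n + k == i.+2)%N]%:R.
Proof.
rewrite /window !coef_sum.
under eq_bigr do rewrite coefMXn.
have [/and3P[k0 n0 /eqP nk]|h] := boolP [&& _, _ & _].
  have ni : (n.-1 < i.+1)%N by lia.
  rewrite (bigD1 (Ordinal ni)) //= big1 => [|x xn].
    rewrite addr0; have -> : (k < (i - n.-1).+1)%N = false by lia.
    by rewrite coefC (_ : (k - _ == 0)%N) ?coefXn ?prednK ?eqxx //; lia.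
  case: ifP => h; first by rewrite coef0.
  rewrite coefC; case: eqP => h2; last by rewrite coef0.
  rewrite coefXn; case: eqP => // h3; case/eqP: xn; apply: val_inj => /=; lia.
rewrite big1 // => x _; have := ltn_ord x.
case: ifP => h1 xi; first by rewrite coef0.
rewrite coefC; case: eqP => h2; last by rewrite coef0.
by rewrite coefXn; case: eqP => // h3; case/negP: h; lia.
Qed.

(** The i-th link takes x_i + 1 edges of the face of length r, so the x_i add up to r - t; the total
    degree takes care of the other face. *)
Lemma coef_prod_window t (l : 'I_t -> nat) r s : (\sum_i (l i).+2 = r + s)%N ->
  (\prod_i window (l i))`_s`_r = (nsolutions l (r%:Z - t%:Z))%:R.
Proof.
move=> lrs; set N := (\max_i l i)%N.
have lN i : (l i <= N)%N by exact: leq_bigmax.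
(* A common bound [N], with zero terms beyond [l i], allows the product of sums to be expanded over
   non-dependent functions. *)
pose term (i : 'I_t) (x : 'I_N.+1) : {poly {poly A}} :=
  if (x <= l i)%N then ('X^(x.+1))%:P * 'X^((l i - x).+1) else 0.
have -> : \prod_i window (l i) = \prod_i \sum_x term i x.
  apply: eq_bigr => i _; rewrite /window.
  rewrite (big_ord_widen N.+1 (fun x => ('X^(x.+1))%:P * 'X^((l i - x).+1))) ?ltnS //.
  by rewrite big_mkcond; apply: eq_bigr => x _; rewrite ltnS.
rewrite bigA_distr_bigA !coef_sum.
pose good (x : {ffun 'I_t -> 'I_N.+1}) :=
  [forall i, (x i <= l i)%N] && (\sum_i (x i).+1 == r)%N.
rewrite (eq_bigr (fun x => (good x)%:R)) => [|x _]; last first.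
  rewrite /good; case: forallP => [xl|nxl] /=; last first.
    have [i xi] : exists i, ~~ (x i <= l i)%N.
      apply/existsP; rewrite -negb_forall; apply/negP => /forallP h.
      by apply: nxl.
    by rewrite (bigD1 i) //= /term (negPf xi) mul0r !coef0.
  rewrite (eq_bigr (fun i => ('X^((x i).+1))%:P * 'X^((l i - x i).+1))) => [|i _]; last first.
    by rewrite /term xl.
  rewrite big_split /= prodrXr -rmorph_prod /= prodrXr coefCM coefXn.
  have ab : (\sum_i (x i).+1 + \sum_i (l i - x i).+1 = r + s)%N.
    by rewrite -big_split -lrs; apply: eq_bigr => i _ /=; have := xl i; lia.
  have -> : (s == \sum_i (l i - x i).+1)%N = (r == \sum_i (x i).+1)%N by lia.
  by rewrite eq_sym; case: eqP => [->|_]; rewrite ?mulr0 ?coef0 // mulr1 coefXn eqxx.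
rewrite -natr_sum -big_mkcond sum1_card; congr (_%:R).
rewrite /nsolutions -(card_in_imset (f := fun x : {dffun forall i : 'I_t, 'I_(l i).+1} =>
  [ffun i => inord (x i)] : {ffun 'I_t -> 'I_N.+1})); last first.
  move=> x y _ _ /ffunP e; apply/ffunP => i; apply: val_inj.
  have bd (z : {dffun forall i : 'I_t, 'I_(l i).+1}) : (z i < N.+1)%N.
    by rewrite (leq_trans (ltn_ord (z i))) ?ltnS ?lN.
  by have := congr1 val (e i); rewrite !ffunE /= !inordK ?bd.
apply: eq_card => x; rewrite unfold_in; apply/idP/imsetP.
  case/andP => /forallP xl /eqP xr.
  exists [ffun i => inord (x i)].
    rewrite inE; apply/eqP.
    rewrite (eq_bigr (fun i => (x i).+1%:Z - 1)) => [|i _]; last first.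
      by rewrite ffunE inordK ?ltnS //; lia.
    rewrite sumrB sumr_const card_ord -xr; congr (_ - _); last by rewrite natz.
    by rewrite -natz natr_sum; apply: eq_bigr => i _; rewrite natz.
  apply/ffunP => i; apply: val_inj; rewrite ffunE [in RHS]ffunE.
  have xi : (inord (x i) : 'I_(l i).+1) = x i :> nat by rewrite inordK ?ltnS.
  by rewrite /= xi inord_val.
case=> y; rewrite inE => /eqP yr ->; apply/andP.
have yN i : (y i < N.+1)%N by rewrite (leq_trans (ltn_ord (y i))) ?ltnS ?lN.
split; first by apply/forallP => i; rewrite ffunE inordK // -ltnS.
rewrite -eqz_nat -natz natr_sum; apply/eqP.
rewrite (eq_bigr (fun i => (y i)%:Z + 1)) => [|i _]; last first.
  by rewrite ffunE inordK // natz -addn1 PoszD.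
by rewrite big_split /= yr sumr_const card_ord natz; lia.
Qed.

End Windows.

Lemma rmorph_window (A B : comNzRingType) (phi : {rmorphism A -> B}) i :
  map_poly (map_poly phi) (window A i) = window B i.
Proof.
apply/polyP => k; apply/polyP => n.
by rewrite !coef_map /= !coef_window rmorph_nat.
Qed.

Definition cumulant_var (C : comNzRingType) k (j : nat) : {mpoly C[k]} :=
  oapp (fun i : 'I_k => 'X_i) 0 (insub (j - 2)%N).

Section Chain.
Variables (C : comNzRingType) (r s : nat).
Local Notation k := (r + s)%N.
Local Notation F := (chain_poly (@cumulant_var C k) r s 0).

Lemma agree_chain_windows :
  agree r s F (\sum_(i < k) ('X_i)%:P%:P * window {mpoly C[k]} i).
Proof.
move=> b a bs ar; rewrite coef_chain_poly bs ar /= !coef_sum.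
under eq_bigr do rewrite coefCM coefCM coef_window.
case: ifP => [/andP[b0 a0]|ab]; last first.
  rewrite big1 // => i _; rewrite andbA ab mulr0 //.
rewrite /cumulant_var; case: insubP => [i ik iE|]; last first.
  rewrite -leqNgt => kab /=; rewrite big1 // => i _; have := ltn_ord i => ik.
  have -> : (a + b == i.+2)%N = false by lia.
  by rewrite !andbF mulr0.
rewrite (bigD1 i) //= big1 => [|i' ne].
  have -> : (a + b == i.+2)%N by rewrite iE; lia.
  by rewrite b0 a0 mulr1 addr0.
have -> : (a + b == i'.+2)%N = false.
  by apply/negbTE; apply: contra ne => /eqP e; apply/eqP/val_inj; rewrite /= iE; lia.
by rewrite !andbF mulr0.
Qed.

(** The power expands over words [phi], the l-th link carrying the cumulant of index [phi l + 2]. By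
    [card_colourings_of] the words with a given monomial number |Perm(j)|. *)
Lemma coef_chain_exp T : (F ^+ T)`_s`_r =
  \sum_(phi : {ffun 'I_T -> 'I_k})
     (\prod_l window C (phi l))`_s`_r *: 'X_[\sum_l U_(phi l)].
Proof.
rewrite (agreeX T agree_chain_windows) //.
have E (G : {poly {poly {mpoly C[k]}}}) : G ^+ T = \prod_(l < T) G.
  by rewrite prodr_const card_ord.
rewrite E bigA_distr_bigA coef_sum coef_sum.
apply: eq_bigr => phi _; rewrite big_split /= -!rmorph_prod /= !coefCM.
rewrite (big_morph _ (@mpolyXD _ C) (mpolyX0 _ C)) mulrC -mul_mpolyC; congr (_ * _).
have -> : \prod_i window {mpoly C[k]} (phi i) =
    map_poly (map_poly (@mpolyC _ C)) (\prod_i window C (phi i)).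
  by rewrite rmorph_prod; apply: eq_bigr => i _; exact/esym/rmorph_window.
by rewrite !coef_map.
Qed.

Lemma cumulant_monomial_eq T t (phi : {ffun 'I_T -> 'I_k}) (j : t.-tuple nat) :
  (forall i, 2 <= tnth j i)%N -> (\sum_(i < t) tnth j i = k)%N ->
  (\sum_l U_(phi l) == cumulant_monomial k j)%MM =
  perm_eq [seq (phi l).+2 | l <- enum 'I_T] j.
Proof.
move=> j2 jk.
have cnt (i : 'I_k) : (\sum_l U_(phi l))%MM i = count_mem i.+2 [seq (phi l).+2 | l <- enum 'I_T].
  rewrite mnm_sumE count_map -sum1_count big_enum_cond /= [RHS]big_mkcond.
  by apply: eq_bigr => l _; rewrite mnm1E /= !eqSS val_eqE; case: eqP.
apply/eqP/idP => [e|pe]; last first.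
  by apply/mnmP => i; rewrite cnt mnmE; exact: (seq.permP pe).
apply/allP => x; rewrite mem_cat => xin.
suff [i ->] : exists i : 'I_k, x = i.+2.
  by rewrite /= -cnt e mnmE.
case/orP: xin => [/mapP[l _ ->]|/tnthP[i xE]]; first by exists (phi l).
have x2 : (2 <= x)%N by rewrite xE.
have xk : (x <= k)%N by rewrite xE -jk (bigD1 i) //= leq_addr.
have lt : (x - 2 < k)%N by lia.
by exists (Ordinal lt) => /=; lia.
Qed.

Lemma card_colourings_of t (j : t.-tuple nat) :
  (forall i, 2 <= tnth j i)%N -> (\sum_(i < t) tnth j i = k)%N ->
  #|[pred phi : {ffun 'I_t -> 'I_k} | perm_eq [seq (phi l).+2 | l <- enum 'I_t] j]|
  = size (permutations j).
Proof.
move=> j2 jk; pose g (phi : {ffun 'I_t -> 'I_k}) := [seq (phi l).+2 | l <- enum 'I_t].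
have g_inj : injective g.
  move=> f h fh; apply/ffunP => l; apply/val_inj/succn_inj/succn_inj.
  by have /eq_in_map/(_ l (mem_enum _ _)) := fh.
rewrite cardE -(size_map g); apply: perm_size; apply: uniq_perm.
- by rewrite map_inj_uniq // enum_uniq.
- exact: permutations_uniq.
move=> x; rewrite mem_permutations; apply/mapP/idP => [[phi]|pe].
  by rewrite mem_enum inE => pe ->; exact: pe.
have szx : size x = t by rewrite (perm_size pe) size_tuple.
have bd l : (l < t)%N -> exists i : 'I_k, nth 0%N x l = i.+2.
  move=> lt; have : nth 0%N x l \in j by rewrite -(perm_mem pe) mem_nth ?szx.
  case/tnthP => i xE; have x2 := j2 i; rewrite -xE in x2.
  have xk : (nth 0%N x l <= k)%N by rewrite xE -jk (bigD1 i) //= leq_addr.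
  have lt2 : (nth 0%N x l - 2 < k)%N by lia.
  by exists (Ordinal lt2) => /=; lia.
have k0 : (0 < t)%N -> (0 < k)%N.
  by move=> t0; have [i _] := bd 0%N t0; exact: leq_ltn_trans (ltn_ord i).
have [phi phiE] : exists phi : {ffun 'I_t -> 'I_k}, forall l, (phi l).+2 = nth 0%N x l.
  have bd' (l : 'I_t) : {i : 'I_k | i.+2 == nth 0%N x l}.
    apply: sigW; have [i e] := bd l (ltn_ord l).
    by exists i; rewrite e.
  by exists [ffun l => sval (bd' l)] => l; rewrite ffunE; apply/eqP/(svalP (bd' l)).
have gE : g phi = x.
  apply: (@eq_from_nth _ 0%N); rewrite /g size_map size_enum_ord ?szx // => l lt.
  by rewrite (nth_map (Ordinal lt)) ?size_enum_ord // phiE nth_enum_ord.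
by exists phi; rewrite ?gE // mem_enum inE -/(g phi) gE.
Qed.

Lemma mcoeff_chain_exp T t (j : t.-tuple nat) :
  (forall i, 2 <= tnth j i)%N -> (\sum_(i < t) tnth j i = k)%N ->
  ((F ^+ T)`_s`_r)@_(cumulant_monomial k j) =
  if T == t then (size (permutations j))%:R *
    (nsolutions (fun i : 'I_t => (tnth j i - 2)%N) (r%:Z - t%:Z))%:R else 0.
Proof.
move=> j2 jk; rewrite coef_chain_exp raddf_sum /=.
rewrite (eq_bigr (fun phi : {ffun 'I_T -> 'I_k} =>
   (\prod_l window C (phi l))`_s`_r * (perm_eq [seq (phi l).+2 | l <- enum 'I_T] j)%:R)); last first.
  by move=> phi _; rewrite mcoeffZ mcoeffX cumulant_monomial_eq.
case: eqP => [Tt|ne]; last first.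
  rewrite big1 // => phi _; case: (boolP (perm_eq _ _)) => [/perm_size|_]; last by rewrite mulr0.
  by rewrite size_map size_enum_ord size_tuple => /ne.
move: Tt => ->; rewrite -(card_colourings_of j2 jk) -sum1_card natr_sum mulr_suml.
rewrite [RHS]big_mkcond; apply: eq_bigr => phi _; rewrite inE.
case: ifP => [pe|_]; last by rewrite mulr0.
rewrite mulr1 mul1r -(@coef_prod_window C _ _ r s); last first.
  by rewrite -jk; apply: eq_bigr => i _; have := j2 i; lia.
suff -> : \prod_l window C (phi l) = \prod_(i < t) window C (tnth j i - 2) by [].
(* The product depends only on the multiset of link indices, so every rearrangement of [j] has the
   same coefficient. *)
transitivity (\prod_(x <- [seq (phi l).+2 | l <- enum 'I_t]) window C (x - 2)).
  by rewrite big_map big_enum; apply: eq_bigr => l _; rewrite subn2.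
by rewrite (perm_big _ pe) big_tuple.
Qed.

End Chain.

(** * From power series to values *)

From mathcomp Require Import finmap multiset complex reals boolp classical_sets.
From mathcomp Require Import functions cardinality fsbigop.

Local Open Scope mset_scope.
Local Open Scope ring_scope.

Section Truncation.
Variables (I : choiceType) (C : comNzRingType) (V : pred I).
Local Notation S := (mseries I C).

(** Sets the indeterminates outside [V] to 0. It is multiplicative because a product of monomials
    lies in [V] exactly when both factors do. *)
Definition truncate (f : S) : S :=
  MSeries (fun d => if all V d then mscoef f d else 0).

Lemma all_msetD (d e : {mset I}) : all V (d `+` e) = all V d && all V e.
Proof.
apply/allP/andP => [h|[/allP hd /allP he] x].
  by split; apply/allP => x xd; apply: h; rewrite in_msetD xd ?orbT.
by rewrite in_msetD => /orP[/hd|/he].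
Qed.

Lemma truncate_is_zmod_morphism : zmod_morphism truncate.
Proof.
move=> f g; apply/mseriesP => d /=.
by case: ifP => _; rewrite // subr0.
Qed.

Lemma truncateM f g : truncate (f * g) = truncate f * truncate g.
Proof.
apply/mseriesP => d.
change ((if all V d then mscoef (msmul f g) d else 0) =
  mscoef (msmul (truncate f) (truncate g)) d).
rewrite !msmulE; case: ifP => Vd.
  rewrite big_seq [RHS]big_seq; apply: eq_bigr => e; rewrite mem_mdivs => ed /=.
  by move: Vd; rewrite -{1}(msetBDKC ed) all_msetD => /andP[-> ->].
rewrite big_seq big1 // => e; rewrite mem_mdivs => ed /=.
move: Vd; rewrite -{1}(msetBDKC ed) all_msetD.
by case: ifP; case: ifP; rewrite ?mulr0 ?mul0r // => -> ->.
Qed.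

Lemma truncate1 : truncate 1 = 1.
Proof.
apply/mseriesP => d /=; case: ifP => //.
by case: eqVneq => // ->; rewrite enum_mset0.
Qed.

HB.instance Definition _ := GRing.isZmodMorphism.Build S S truncate
  truncate_is_zmod_morphism.
HB.instance Definition _ := GRing.isMonoidMorphism.Build S S truncate
  (conj truncate1 truncateM).

Lemma truncateZ c f : truncate (c *: f) = c *: truncate f.
Proof. by apply/mseriesP => d /=; case: ifP; rewrite // mulr0. Qed.

Lemma mscoef_sum (J : Type) (r : seq J) (P : pred J) (f : J -> S) d :
  mscoef (\sum_(j <- r | P j) f j) d = \sum_(j <- r | P j) mscoef (f j) d.
Proof. by elim/big_rec2: _ => // j x y _ <-. Qed.

Lemma msmonom_prod (J : Type) (r : seq J) (P : pred J) (f : J -> {mset I}) :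
  \prod_(j <- r | P j) msmonom (f j) =
  msmonom (\big[msetD/mset0]_(j <- r | P j) f j) :> S.
Proof. by elim/big_rec2: _ => // j x y _ ->; rewrite -msmonomD. Qed.

End Truncation.

Section Embedding.
Variables (I : choiceType) (C : comNzRingType) (n : nat) (v : 'I_n -> I).
Hypothesis inj_v : injective v.
Local Notation S := (mseries I C).

Definition embed (P : {mpoly C[n]}) : S := mmap (in_alg S) (fun i => msvar (v i)) P.

Definition mset_of (e : 'X_{1..n}) : {mset I} :=
  \big[msetD/mset0]_(i < n) msetn (e i) (v i).

Lemma mset_ofE e i : mset_of e (v i) = e i.
Proof.
rewrite /mset_of (_ : forall x, (\big[msetD/mset0]_(i < n) msetn (e i) (v i)) x =
    \sum_(i < n) msetn (e i) (v i) x)%N; last first.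
  by move=> x; elim/big_rec2: _ => [|k y z _ <-]; rewrite ?mset0E // msetE2.
rewrite (bigD1 i) //= msetnxx big1 ?addn0 // => k ki.
by rewrite msetnE (inj_eq inj_v) eq_sym (negPf ki).
Qed.

Lemma msvarX (x : I) k : msvar x ^+ k = msmonom (msetn k x) :> S.
Proof.
elim: k => [|k IH]; first by rewrite expr0 msetn0.
rewrite exprS IH -msmonomD; congr msmonom; apply/msetP => y.
by rewrite msetE2 !msetnE; case: eqP.
Qed.

Lemma mscoef_embed P e : mscoef (embed P) (mset_of e) = P@_e.
Proof.
rewrite /embed /mmap mscoef_sum.
have E e' : mmap1 (fun i => msvar (v i)) e' = msmonom (mset_of e') :> S.
  by rewrite -msmonom_prod; apply: eq_bigr => i _; rewrite msvarX.
rewrite (eq_bigr (fun e' => P@_e' * (e == e')%:R)) => [|e' _].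
  have [eP|eP] := boolP (e \in msupp P).
    rewrite (bigD1_seq e) ?msupp_uniq //= eqxx mulr1 big1 ?addr0 // => e' /negPf.
    by rewrite eq_sym => ->; rewrite mulr0.
  rewrite (memN_msupp_eq0 eP) big_seq big1 // => e' e'P.
  by case: eqVneq => [ee|_]; [rewrite ee e'P in eP|rewrite mulr0].
rewrite E mulr_algl /=; congr (_ * (nat_of_bool _)%:R).
apply/eqP/eqP => [h|->//]; apply/mnmP => i.
by rewrite -!mset_ofE h.
Qed.

Lemma embed_inj : injective embed.
Proof.
by move=> P Q PQ; apply/mpolyP => e; rewrite -!mscoef_embed PQ.
Qed.

HB.instance Definition _ := GRing.RMorphism.copy embed
  (mmap (in_alg S) (fun i => msvar (v i))).

End Embedding.

Section Transfer.
Variables (C : comNzRingType) (m : nat).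
Local Notation M := m.+1.

Definition colour_index (i : 'I_(M + M)) : nat + nat :=
  match fintype.split i with inl a => inl (nat_of_ord a) | inr b => inr (nat_of_ord b) end.

Lemma colour_index_inj : injective colour_index.
Proof.
move=> i j; rewrite /colour_index => e.
rewrite -(fintype.splitK i) -(fintype.splitK j); congr unsplit.
by case: (fintype.split i) (fintype.split j) e => a [] b // [] /val_inj ->.
Qed.

Definition small_colour (x : nat + nat) : bool :=
  match x with inl a => (a < M)%N | inr b => (b < M)%N end.

Definition pX (a : 'I_M) : {mpoly C[M + M]} := 'X_(lshift M a).
Definition qX (a : 'I_M) : {mpoly C[M + M]} := 'X_(rshift M a).
Let emb := @embed _ C _ colour_index.

Lemma embed_pX a : emb (pX a) = pvar a.
Proof. by rewrite /emb /embed /pX mmapX mmap1U /colour_index (fintype.unsplitK (inl a)). Qed.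

Lemma embed_qX a : emb (qX a) = qvar a.
Proof. by rewrite /emb /embed /pX mmapX mmap1U /colour_index (fintype.unsplitK (inr a)). Qed.

Section Nseries.
Variables (k : nat) (a b : 'S_k).

Definition nat_colouring (f : {ffun orbits a -> 'I_M}) (h : {ffun orbits b -> 'I_M}) :
  colouring a b :=
  [ffun z => match z with inl w => nat_of_ord (f w) | inr w => nat_of_ord (h w) end].

Lemma nat_colouringl f h w : nat_colouring f h (inl w) = f w :> nat.
Proof. by rewrite ffunE. Qed.

Lemma nat_colouringr f h w : nat_colouring f h (inr w) = h w :> nat.
Proof. by rewrite ffunE. Qed.

Definition colour_mset (psi : colouring a b) : {mset (nat + nat)%type} :=
  (\big[msetD/mset0]_(w : orbits a) [mset inl (psi (inl w))]) `+`
  (\big[msetD/mset0]_(w : orbits b) [mset inr (psi (inr w))]).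

Lemma colour_monomialE psi : colour_monomial C psi = msmonom (colour_mset psi).
Proof. by rewrite /colour_monomial !msmonom_prod -msmonomD. Qed.

Lemma small_colour_mset psi : all small_colour (colour_mset psi) =
  [forall z, (psi z < M)%N].
Proof.
have big (J : finType) (v : J -> (nat + nat)%type) :
    all small_colour ((\big[msetD/mset0]_(z : J) [mset v z]) : {mset _}) =
    [forall z, small_colour (v z)].
  have -> : [forall z, small_colour (v z)] = \big[andb/true]_(z : J) small_colour (v z).
    by rewrite big_andE.
  elim/big_rec2: _ => [|z x y _ <-]; first by rewrite enum_mset0.
  by rewrite all_msetD enum_msetn /= andbT.
rewrite /colour_mset all_msetD !big; apply/andP/forallP => [[/forallP f /forallP h] z|h].
  by case: z => z; [exact: f|exact: h].
by split; apply/forallP => z; exact: h.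
Qed.

(** A colouring with a colour outside the first M yields a monomial that truncation removes, so the
    infinite sum becomes a finite one. *)
Lemma truncate_Nseries : truncate small_colour (Nseries C a b) =
  emb (pair_weight pX qX a b).
Proof.
have -> : emb (pair_weight pX qX a b) = \sum_(fh : {ffun orbits a -> 'I_M} * {ffun orbits b -> 'I_M}
    | [forall x, (fh.1 (orb a x) <= fh.2 (orb b x))%N])
    colour_monomial C (nat_colouring fh.1 fh.2).
  rewrite pair_weight_orbits /emb rmorph_sum /=; rewrite [RHS]big_mkcond -(pair_bigA _
    (fun (f : {ffun orbits a -> 'I_M}) (h : {ffun orbits b -> 'I_M}) => if [forall x, (f (orb a x) <= h (orb b x))%N] then
      colour_monomial C (nat_colouring f h) else 0)) /=.
  apply: eq_bigr => f _; rewrite rmorph_sum; apply: eq_bigr => h _.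
  rewrite rmorphM rmorph_nat; case: ifP => _; rewrite ?mul0r // mul1r rmorphM !rmorph_prod.
  congr (_ * _); apply: eq_bigr => w _; rewrite ffunE; first exact: embed_pX.
  exact: embed_qX.
apply/mseriesP => d; rewrite mscoef_sum.
transitivity (if all (small_colour) (d : {mset _}) then
  \sum_(psi \in @admissible k a b) mscoef (colour_monomial C psi) d else 0); first by [].
case: ifP => Vd; last first.
  rewrite big1 // => fh _; rewrite colour_monomialE /=.
  case: eqVneq => // dE; move: Vd; rewrite dE small_colour_mset => /negP[].
  by apply/forallP => -[] w; rewrite ffunE ltn_ord.
pose r := [seq nat_colouring fh.1 fh.2 | fh <- enum
  [pred fh : {ffun orbits a -> 'I_M} * {ffun orbits b -> 'I_M} |
     [forall x, (fh.1 (orb a x) <= fh.2 (orb b x))%N]]].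
have inj_nc : injective (fun fh : {ffun orbits a -> 'I_M} * {ffun orbits b -> 'I_M} =>
    nat_colouring fh.1 fh.2).
  move=> [f h] [f' h'] /= /ffunP e; congr (_, _); apply/ffunP => w; apply: val_inj.
    by have := e (inl w); rewrite !ffunE.
  by have := e (inr w); rewrite !ffunE.
have rA : ([set` r] `<=` @admissible k a b)%classic.
  move=> psi /= /mapP[fh]; rewrite mem_enum /= => /forallP fhP {psi}-> w w' ww'.
  (* Admissibility is about intersecting orbits, [pair_weight] about points: a common point x
     identifies them as [orb a x] and [orb b x]. *)
  case/pred0Pn: ww' => x /= /andP[xw xw'].
  have <- : orb a x = w.
    apply: val_inj; rewrite /=; case/imsetP: (valP w) xw => y _ -> xy.
    by apply/eqP; rewrite eq_porbit_mem.
  have <- : orb b x = w'.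
    apply: val_inj; rewrite /=; case/imsetP: (valP w') xw' => y _ -> xy.
    by apply/eqP; rewrite eq_porbit_mem.
  by rewrite nat_colouringl nat_colouringr; exact: fhP.
rewrite (fsbigE r) //.
- rewrite big_seq_cond (eq_bigl (fun i => i \in r)) => [|psi]; last first.
    by apply: andb_idr => /rA/mem_set.
  by rewrite -big_seq big_map big_enum; exact: eq_bigl.
- by rewrite map_inj_uniq ?enum_uniq.
move=> psi adm; apply: contraNeq; rewrite colour_monomialE /=.
case: (eqVneq d) => [dE _|_]; last by rewrite eqxx.
move: Vd; rewrite dE small_colour_mset => /forallP small.
apply/mapP; exists ([ffun w => inord (psi (inl w))], [ffun w => inord (psi (inr w))]).
  rewrite mem_enum; apply/forallP => x; rewrite !ffunE !inordK ?small //.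
  apply: adm => /=; apply/pred0Pn; exists x; rewrite /= !porbit_id.
  by [].
by apply/ffunP => -[w|w]; rewrite !ffunE inordK ?small.
Qed.

End Nseries.

End Transfer.

Section Transfer.
Variables (C : comNzRingType) (m : nat).
Local Notation M := m.+1.
Local Notation emb := (@embed _ C _ (@colour_index m)).
Local Notation tr := (@truncate _ C (small_colour m)).

Lemma truncate_free_cumulant j : tr (free_cumulant C j) = emb (free_cum (@pX C m) (@qX C m) j).
Proof.
rewrite /free_cumulant /free_cum rmorph_sum [RHS]rmorph_sum; apply: eq_bigr => a _.
rewrite rmorph_sum [RHS]rmorph_sum; apply: eq_bigr => b _.
by rewrite rmorphM rmorphXn rmorphN1 /= truncate_Nseries [RHS]rmorphM rmorphXn rmorphN1.
Qed.

Lemma truncate_Sigma' k (sg : 'S_k) :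
  tr (Sigma' C sg) = emb (transitive_sum (@pX C m) (@qX C m) sg).
Proof.
rewrite /Sigma' /transitive_sum rmorph_sum [RHS]rmorph_sum; apply: eq_bigr => a _.
rewrite rmorph_sum [RHS]rmorph_sum; apply: eq_bigr => b _.
by rewrite rmorphM rmorphXn rmorphN1 /= truncate_Nseries [RHS]rmorphM rmorphXn rmorphN1.
Qed.

Lemma rmorph_mmap n (A B : comNzRingType) (phi : {rmorphism A -> B})
    (f : {rmorphism C -> A}) (g : {rmorphism C -> B}) (h : 'I_n -> A) (K : {mpoly C[n]}) :
  phi \o f =1 g -> phi (mmap f h K) = mmap g (phi \o h) K.
Proof.
move=> fg; rewrite /mmap rmorph_sum; apply: eq_bigr => e _.
rewrite rmorphM; congr (_ * _); first exact: fg.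
by rewrite rmorph_prod; apply: eq_bigr => i _; rewrite rmorphXn.
Qed.

Lemma transitive_sum_mpoly k (sg : 'S_k) (K : {mpoly C[k]}) :
  Sigma' C sg = eval_free_cumulants K ->
  transitive_sum (@pX C m) (@qX C m) sg =
  mmap (@mpolyC _ C) (fun i => free_cum (@pX C m) (@qX C m) i.+2) K.
Proof.
move=> SK; apply: (@embed_inj _ C _ (@colour_index m) (@colour_index_inj m)).
rewrite -truncate_Sigma' SK /eval_free_cumulants.
rewrite (@rmorph_mmap _ _ _ tr _ (in_alg (mseries (nat + nat)%type C))); last first.
  by move=> c /=; rewrite truncateZ truncate1.
rewrite (@rmorph_mmap _ _ _ emb _ (in_alg (mseries (nat + nat)%type C))); last first.
  by move=> c /=; rewrite /embed mmapC.
congr (mmap _ _ _); apply/funext => i /=; exact: truncate_free_cumulant.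
Qed.

(** The truncated identity holds for independent indeterminates, hence after any substitution of
    weights. *)
Lemma transitive_sumE (A : comNzRingType) (f : {rmorphism C -> A}) (p q : 'I_M -> A)
    k (sg : 'S_k) (K : {mpoly C[k]}) :
  Sigma' C sg = eval_free_cumulants K ->
  transitive_sum p q sg = mmap f (fun i => free_cum p q i.+2) K.
Proof.
move/transitive_sum_mpoly => SK.
pose h (i : 'I_(M + M)) := match fintype.split i with inl a => p a | inr b => q b end.
have pE : mmap f h \o @pX C m =1 p.
  by move=> a /=; rewrite mmapX mmap1U /h (fintype.unsplitK (inl a)).
have qE : mmap f h \o @qX C m =1 q.
  by move=> a /=; rewrite mmapX mmap1U /h (fintype.unsplitK (inr a)).
rewrite -(funext pE) -(funext qE) -rmorph_transitive_sum SK.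
rewrite (@rmorph_mmap _ _ _ (mmap f h) _ f); last by move=> c /=; rewrite mmapC.
by congr (mmap _ _ _); apply/funext => i; rewrite /= rmorph_free_cum.
Qed.

End Transfer.

(** * The part of top degree *)

Section Top.
Variables (C A : comNzRingType) (f : {rmorphism C -> A}) (m : nat) (p q : 'I_m.+1 -> A).

Definition weighted_degree k (e : 'X_{1..k}) : nat := (\sum_(i < k) i.+2 * e i)%N.

Definition top_part k (K : {mpoly C[k]}) : {mpoly C[k]} :=
  \sum_(e <- msupp K | weighted_degree e == k) K@_e *: 'X_[e].

Lemma mcoeff_top_part k (K : {mpoly C[k]}) e : weighted_degree e = k ->
  (top_part K)@_e = K@_e.
Proof.
move=> ek; rewrite /top_part raddf_sum /=.
have [eK|eK] := boolP (e \in msupp K); last first.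
  rewrite (memN_msupp_eq0 eK) big1_seq // => e' /andP[_ e'K].
  rewrite mcoeffZ mcoeffX; case: eqVneq => [ee|_]; last by rewrite mulr0.
  by rewrite -ee e'K in eK.
rewrite big_mkcond (bigD1_seq e) ?msupp_uniq //= ek eqxx mcoeffZ mcoeffX eqxx mulr1.
rewrite big1 ?addr0 // => e' /negPf ne.
by case: ifP => // _; rewrite mcoeffZ mcoeffX ne mulr0.
Qed.

(** Each vertex receives one factor X, so the power of X counts vertices; R_j, whose pairs all have
    j vertices, becomes homogeneous of degree j. *)
Let P (c : 'I_m.+1) : {poly A} := 'X * (p c)%:P.
Let Q (c : 'I_m.+1) : {poly A} := 'X * (q c)%:P.

Lemma pair_weight_X k (a b : 'S_k) :
  pair_weight P Q a b = 'X^(#|porbits a| + #|porbits b|) * (pair_weight p q a b)%:P.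
Proof. by rewrite pair_weight_scale -exprD rmorph_pair_weight. Qed.

Lemma free_cum_X j : free_cum P Q j.+2 = 'X^(j.+2) * (free_cum p q j.+2)%:P.
Proof.
rewrite /free_cum rmorph_sum mulr_sumr; apply: eq_bigr => a _.
rewrite rmorph_sum mulr_sumr; apply: eq_bigr => b /andP[_ /eqP ab].
rewrite pair_weight_X ab mulrCA; congr (_ * _).
by rewrite rmorphM rmorphXn rmorphN1.
Qed.

(** Coefficients of X^k are compared: maps with k vertices on one side, monomials of graded degree k
    on the other. *)
Lemma top_transitive_sum k (sg : 'S_k) (K : {mpoly C[k]}) :
  Sigma' C sg = eval_free_cumulants K ->
  \sum_(a : 'S_k) \sum_(b : 'S_k | [&& (a * b == sg)%g,
      [transitive <<[set a; b]>>, on [set: 'I_k] | 'P]%g &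
      (#|porbits a| + #|porbits b| == k)%N])
    (-1) ^+ #|porbits a|.+1 * pair_weight p q a b =
  mmap f (fun i => free_cum p q i.+2) (top_part K).
Proof.
move/(transitive_sumE (polyC \o f) P Q)/(congr1 (fun z : {poly A} => z`_k)).
rewrite /transitive_sum coef_sum => e.
have sgn n : (-1) ^+ n = ((-1) ^+ n)%:P :> {poly A} by rewrite rmorphXn rmorphN1.
transitivity ((mmap (polyC \o f) (fun i : 'I_k => free_cum P Q i.+2) K)`_k).
  rewrite -e; apply: eq_bigr => a _; rewrite coef_sum [LHS]big_mkcond [RHS]big_mkcond /=.
  apply: eq_bigr => b _; rewrite andbA; case: ifP => [/andP[->]|].
    move=> /eqP ek; rewrite pair_weight_X ek mulrCA sgn -polyCM.
    by rewrite coefXnM ltnn subnn coefC eqxx.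
  case: ifP => //= _ /negbT ne; rewrite pair_weight_X mulrCA sgn -polyCM.
  rewrite coefXnM; case: ltnP => // le; rewrite coefC; case: eqP => // /eqP.
  by rewrite subn_eq0 => le'; case/eqP: ne; apply/eqP; rewrite eqn_leq le le'.
rewrite /top_part [RHS]rmorph_sum /= big_mkcond [in LHS]/mmap coef_sum; apply: eq_bigr => e' _.
have -> : mmap1 (fun i : 'I_k => free_cum P Q i.+2) e' =
    'X^(weighted_degree e') * (mmap1 (fun i => free_cum p q i.+2) e')%:P.
  rewrite /mmap1 rmorph_prod /weighted_degree.
  rewrite -prodrXr -big_split; apply: eq_bigr => i _.
  by rewrite free_cum_X exprMn -exprM -rmorphXn.
rewrite mulrCA -polyCM coefXnM coefC.
rewrite subn_eq0; case: ltngtP => // _.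
by rewrite mmapZ mmapX.
Qed.

End Top.

Lemma weighted_degree_cumulant k t (j : t.-tuple nat) :
  (forall i, 2 <= tnth j i)%N -> (\sum_(i < t) tnth j i = k)%N ->
  weighted_degree (cumulant_monomial k j) = k.
Proof.
move=> j2 jk; rewrite /weighted_degree.
under eq_bigr do rewrite mnmE -sum1_count big_distrr /= big_mkcond.
rewrite exchange_big /= -[RHS]jk -(big_tuple _ _ j xpredT (fun x => x)).
apply: eq_big_seq => x /tnthP[l xE].
have x2 : (2 <= x)%N by rewrite xE.
have xk : (x <= k)%N by rewrite xE -jk (bigD1 l) //= leq_addr.
have lt : (x - 2 < k)%N by lia.
rewrite (bigD1 (Ordinal lt)) //= big1 => [|i ne].
  by rewrite muln1 addn0; case: eqP; lia.
by case: eqP => // xi; case/eqP: ne; apply: val_inj; rewrite /= xi; lia.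
Qed.

Lemma nsolutions_eq0 t (l : 'I_t -> nat) (L : int) :
  ((\sum_i l i)%N%:Z < L) -> nsolutions l L = 0%N.
Proof.
move=> lL; apply/eqP; rewrite cards_eq0; apply/eqP/setP => x; rewrite !inE.
apply/negbTE/eqP => xL; move: lL; rewrite -xL ltNge -natz natr_sum => /negP[].
by apply: ler_sum => i _; rewrite natz lez_nat -ltnS.
Qed.

Section Main.
Variables (C : numFieldType) (r s : nat).
Local Notation k := (r + s)%N.

(** The explicit form of the top part; a chain has [t.+1] links, at most s because each takes an
    edge of the face of length s. *)
Definition annular_poly : {mpoly C[k]} :=
  \sum_(t < s) ((r * s)%N%:R / t.+1%:R) *:
    (chain_poly (@cumulant_var C k) r s 0 ^+ t.+1)`_s`_r.

Lemma mmap_annular_poly (A : comNzRingType) (f : {rmorphism C -> A}) m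
    (p q : 'I_m.+1 -> A) :
  mmap f (fun i => free_cum p q i.+2) annular_poly =
  \sum_(t < s) r%:R * (chain_poly (free_cum p q) r s 0 ^+ t *
                       ('X * (chain_poly (free_cum p q) r s 0)^`()))`_s`_r.
Proof.
rewrite /annular_poly rmorph_sum; apply: eq_bigr => t _ /=; rewrite mmapZ.
rewrite -(@rmorph_chain_poly _ _ (mmap f (fun i : 'I_k => free_cum p q i.+2)) _ (free_cum p q)).
  have -> : (r * s)%N%:R / t.+1%:R = r%:R / t.+1%:R * s%:R :> C.
    by rewrite natrM mulrAC.
  set F := chain_poly (free_cum p q) r s 0.
  have dF : s%:R * (F ^+ t.+1)`_s`_r = t.+1%:R * (F ^+ t * ('X * F^`()))`_s`_r.
    by rewrite !mulr_natl chain_deriv.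
  rewrite rmorphM [f s%:R]rmorph_nat -mulrA dF -(rmorph_nat f t.+1) [LHS]mulrA -rmorphM.
  by rewrite divfK ?pnatr_eq0 // rmorph_nat.
move=> j j1 jk; rewrite /cumulant_var; have lt : (j - 2 < k)%N by lia.
by rewrite insubT /= mmapX mmap1U /=; congr (free_cum _ _ _); lia.
Qed.

End Main.

Lemma top_part_annular (C : numFieldType) (r s : nat) (K : {mpoly C[r + s]}) :
  (1 <= r)%N -> (1 <= s)%N -> is_Kprime [:: r; s] K -> top_part K = annular_poly C r s.
Proof.
move=> r0 s0 [sg ct hS]; apply/eqP; rewrite -subr_eq0; apply/eqP.
apply: (@free_cum_independent _ _ (ltn_addr s r0)) => A f p q; rewrite rmorphB /= mmap_annular_poly.
rewrite -(top_transitive_sum f p q hS) (sum_annular p q _ s0 ct) //.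
exact: subrr.
Qed.

Theorem theorem1p6p2 (R : realType) (r s : nat) (hr : (1 <= r)%N)
    (hs : (1 <= s)%N) (K : {mpoly R[i][r + s]})
    (hK : is_Kprime [:: r; s] K)
    (t : nat) (j : t.-tuple nat)
    (hj : forall i : 'I_t, (2 <= tnth j i)%N)
    (hdeg : (\sum_(i < t) tnth j i)%N = (r + s)%N) :
  K@_(cumulant_monomial (r + s) j) =
    (r * s)%N%:R / t%:R * (size (permutations j))%:R *
    (nsolutions (fun i : 'I_t => (tnth j i - 2)%N) (r%:Z - t%:Z))%:R.
Proof.
rewrite -mcoeff_top_part; last exact: weighted_degree_cumulant.
rewrite (top_part_annular hr hs hK) /annular_poly raddf_sum /=.
under eq_bigr do rewrite mcoeffZ mcoeff_chain_exp //.
have t0 : (0 < t)%N.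
  by case: (t) j hj hdeg => // j _; rewrite big_ord0; lia.
(* [annular_poly] stops at s links. For t > s the bounds add up to r + s - 2t < r - t, so the
   formula gives 0 as well. *)
have [ts|st] := leqP t s; last first.
  rewrite nsolutions_eq0 ?mulr0.
    by rewrite big1 // => i _; have := ltn_ord i; case: eqP => [|_ _]; [lia|rewrite mulr0].
  have : (\sum_i (tnth j i - 2) + t * 2 = r + s)%N.
    have -> : (t * 2 = \sum_(i < t) 2)%N by rewrite sum_nat_const card_ord.
    rewrite -hdeg -big_split /=.
    by apply: eq_bigr => i _; rewrite subnK.
  by move: (\sum_i _)%N => n; lia.
have lt : (t.-1 < s)%N by rewrite prednK.
rewrite (bigD1 (Ordinal lt)) //= prednK // eqxx big1 ?addr0 ?mulrA // => i ne.
case: eqP => [it|_]; last by rewrite mulr0.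
by case/eqP: ne; apply: val_inj; rewrite /= -it.
Qed.
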